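(* Let $d$ be a cardinal with $2\le d\le\omega$. There is a tree $T_d$ on $d^d$ with $\Delta^1_1$ suitable levels such that for each $1\le\xi<\omega_1$: (1) there is a set $\mathbb{S}^d_\xi\in\Sigma^0_\xi([T_d])$ not separable from $[T_d]\setminus\mathbb{S}^d_\xi$ by a $\mathrm{pot}(\Pi^0_\xi)$ set; (2) there are disjoint sets $\mathbb{S}^0_\xi,\mathbb{S}^1_\xi\in\Sigma^0_\xi([T_d])$ not separable by a $\mathrm{pot}(\Delta^0_\xi)$ set.
   Context: $d$ is identified with $\{0,\dots,d-1\}$ (or $\omega$) with the discrete topology; $(d^d)^l$ is identified with $(d^l)^d$ via $\vec\alpha\mapsto((\alpha_i(j))_{i\in d})_{j\in l}$. A tree on $d^d$ is a subset of $(d^d)^{<\omega}$ closed under initial segments; $[T]\subseteq(d^\omega)^d$ is its body. For $\mathcal T\subseteq\mathcal X^d$, $G^{\mathcal T}$ is the graph on $\mathcal T$ whose edges are the pairs of distinct elements with some coordinate in common; $\mathcal T$ is one-sided if distinct elements share at most one coordinate, and almost acyclic if every $G^{\mathcal T}$-cycle $(\vec x^n)_{n\le L}$ admits $i\in d$ and $k<m<n<L$ with $x^k_i=x^m_i=x^n_i$. $T$ has suitable levels if every level $T\cap(d^d)^l$ is finite, one-sided and almost acyclic; it has $\Delta^1_1$ suitable levels if moreover each level is a (lightface) $\Delta^1_1$ subset of the recursively presented space $(d^l)^d$. For a class $\Lambda$ and Polish $X_i$, a Borel $B\subseteq\prod_{i\in d}X_i$ is $\mathrm{pot}(\Lambda)$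 if there are finer 0-dimensional Polish topologies $\tau_i$ on $X_i$ with $B\in\Lambda(\prod(X_i,\tau_i))$; separation of $A$ from $B$ by a $\mathrm{pot}(\Lambda)$ set means a $\mathrm{pot}(\Lambda)$ set containing $A$ and disjoint from $B$. *)

(* Defs.v *)
From HB Require Import structures.
From mathcomp Require Import all_boot all_order all_algebra.
From mathcomp Require Import all_classical all_reals all_analysis.

Set Implicit Arguments.
Unset Strict Implicit.
Unset Printing Implicit Defensive.

Local Open Scope classical_set_scope.

(* The cardinals d <= omega, and d seen as the set of the ordinals below d. *)
Variant card_le_omega := Finite_card of nat | Omega.

Definition below (d : card_le_omega) : pred nat :=
  fun n => if d is Finite_card m then n < m else true.

Definition dset (d : card_le_omega) : choiceType := {n : nat | below d n}.

(* d^omega and (d^omega)^d *)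
Definition dseq (d : card_le_omega) : topologicalType :=
  prod_topology (fun _ : nat => discrete_topology (dset d)).

Definition dpow (d : card_le_omega) : topologicalType :=
  prod_topology (fun _ : dset d => dseq d).

Section BorelHierarchy.
Variables (W : eqType) (le : rel W).

Definition wlt (x y : W) : bool := (x != y) && le x y.

(* A point x of a countable well-order W stands for the ordinal xi < omega_1
   which is the order type of its strict initial segment {y | y < x}. *)
Definition ord_ge1 (x : W) : Prop := exists y, wlt y x.
Definition ord_eq1 (x : W) : Prop := exists! y, wlt y x.

Inductive Sigma0 (T : topologicalType) : W -> set T -> Prop :=
| Sigma0_open x (A : set T) : ord_eq1 x -> open A -> Sigma0 x A
| Sigma0_bigcup x (y : nat -> W) (A : nat -> set T) :
    (forall n, ord_ge1 (y n) /\ wlt (y n) x) ->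
    (forall n, Sigma0 (y n) (~` A n)) ->
    Sigma0 x (\bigcup_n A n).

Definition Pi0 (x : W) (T : topologicalType) : set (set T) :=
  [set A | Sigma0 x (~` A)].

Definition Delta0 (x : W) (T : topologicalType) : set (set T) :=
  [set A | Sigma0 x A /\ Pi0 x A].

End BorelHierarchy.

Definition polish (R : realType) (T : topologicalType) : Prop :=
  (exists2 D : set T, countable D & dense D) /\
  exists m : Metric R T,
    let M : metricType R := Metric.Pack m in
    (forall U : set T, @open M U <-> @open T U) /\
    (forall F : set_system M, ProperFilter F -> cauchy F -> exists x : M, F --> x).

(* The library's zero_dimensional only asks that clopen sets separate points. *)
Definition clopen_basis (T : topologicalType) : Prop := basis (@clopen T).

(* A topology on the carrier of X i is a term of type Topological (X i), as in
   the library's sup_topology. *)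
Definition pot (R : realType) (L : forall T : topologicalType, set (set T))
    (I : Type) (X : I -> topologicalType) (B : set (prod_topology X)) : Prop :=
  <<s @open (prod_topology X) >> B /\
  exists tau : forall i, Topological (X i),
    let Xt i : topologicalType := Topological.Pack (tau i) in
    [/\ forall i (U : set (X i)), open U -> @open (Xt i) U,
        forall i, polish R (Xt i),
        forall i, clopen_basis (Xt i)
      & L (prod_topology Xt) B].

Definition pot_separable (R : realType)
    (L : forall T : topologicalType, set (set T))
    (I : Type) (X : I -> topologicalType) (A B : set (prod_topology X)) : Prop :=
  exists C : set (prod_topology X), [/\ pot R L C, A `<=` C & C `&` B = set0].

Section Graph.
Variables (I Y : Type) (S : set (I -> Y)).

Definition Gedge (x y : I -> Y) : Prop :=
  [/\ S x, S y, x <> y & exists i, x i = y i].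

Definition Gcycle (x : nat -> I -> Y) (L : nat) : Prop :=
  [/\ 3 <= L,
      forall n, n < L -> Gedge (x n) (x n.+1),
      x 0 = x L
    & forall m n, m < L -> n < L -> x m = x n -> m = n].

Definition one_sided : Prop :=
  forall x y, S x -> S y -> x <> y ->
  forall i j, x i = y i -> x j = y j -> i = j.

Definition almost_acyclic : Prop :=
  forall x L, Gcycle x L ->
  exists i k m n, [/\ k < m, m < n, n < L, x k i = x m i & x m i = x n i].

End Graph.

Section Tree.
Variable d : card_le_omega.
Local Notation D := (dset d).

Definition is_tree (T : set (seq (D -> D))) : Prop :=
  forall s t, T (s ++ t) -> T s.

(* T `&` (d^d)^l, transposed into (d^l)^d *)
Definition level (T : set (seq (D -> D))) (l : nat) : set (D -> l.-tuple D) :=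
  [set x | T [seq (fun i => tnth (x i) j) | j <- enum 'I_l]].
Arguments level T l _ : clear implicits.

Definition body (T : set (seq (D -> D))) : set (dpow d) :=
  [set x | forall l, T (mkseq (fun j i => x i j) l)].

Definition suitable_levels (T : set (seq (D -> D))) : Prop :=
  forall l, [/\ finite_set (level T l),
                one_sided (level T l) & almost_acyclic (level T l)].

End Tree.
Arguments level {d} T l _.

(* Total recursive functions, with minimisation restricted to regular g. *)
Inductive recursive : forall k, (k.-tuple nat -> nat) -> Prop :=
| rec_zero k : recursive (fun _ : k.-tuple nat => 0)
| rec_succ : recursive (fun t : 1.-tuple nat => (thead t).+1)
| rec_proj k (i : 'I_k) : recursive (fun t : k.-tuple nat => tnth t i)
| rec_comp k m (f : m.-tuple nat -> nat) (g : 'I_m -> k.-tuple nat -> nat) :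
    recursive f -> (forall i, recursive (g i)) ->
    recursive (fun t => f [tuple g i t | i < m])
| rec_prim k (g : k.-tuple nat -> nat) (h : k.+2.-tuple nat -> nat) :
    recursive g -> recursive h ->
    recursive (fun t : k.+1.-tuple nat =>
      iteri (thead t) (fun n r => h [tuple of n :: r :: behead_tuple t])
        (g (behead_tuple t)))
| rec_mu k (g : k.+1.-tuple nat -> nat) (f : k.-tuple nat -> nat) :
    recursive g ->
    (forall t, g [tuple of f t :: t] = 0 /\
       forall n, n < f t -> g [tuple of n :: t] <> 0) ->
    recursive f.

Definition recursive1 (e : nat -> nat) : Prop :=
  recursive (fun t : 1.-tuple nat => e (thead t)).

(* A point is described by the graph G of a (partial) function on nat; the list
   [:: k1; v1; k2; v2; ...] stands for the conditions G k1 v1, G k2 v2, ... *)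
Fixpoint sat (G : nat -> nat -> Prop) (c : seq nat) : Prop :=
  if c is k :: v :: c' then G k v /\ sat G c' else True.

Section Effective.
Variables (d : card_le_omega) (l : nat).
Local Notation D := (dset d).
Local Notation X := (D -> l.-tuple D).

(* The coordinate x_i(j) is numbered i * l + j; a condition on a number which
   is not of this form (with i < d, j < l) is unsatisfiable. *)
Definition graph_of (x : X) (k v : nat) : Prop :=
  exists (i : D) (j : 'I_l), k = val i * l + j /\ v = val (tnth (x i) j).

Definition nbhd_X (s : nat) : set X :=
  [set x | sat (graph_of x) (CodeSeq.decode s)].

Definition nbhd_N (s : nat) : set (nat -> nat) :=
  [set b | sat (fun k v => b k = v) (CodeSeq.decode s)].

(* Effectively open sets of (d^l)^d x omega^omega: unions of recursive
   sequences of coded basic open sets. *)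
Definition lightface_Sigma01 (P : set (X * (nat -> nat))) : Prop :=
  exists e0 e1 : nat -> nat, [/\ recursive1 e0, recursive1 e1
    & P = \bigcup_n (nbhd_X (e0 n) `*` nbhd_N (e1 n))].

Definition lightface_Sigma11 (A : set X) : Prop :=
  exists P : set (X * (nat -> nat)),
    lightface_Sigma01 P /\ A = [set x | exists b, ~ P (x, b)].

Definition lightface_Delta11 (A : set X) : Prop :=
  lightface_Sigma11 A /\ lightface_Sigma11 (~` A).

End Effective.

Definition Delta11_suitable_levels (d : card_le_omega)
    (T : set (seq (dset d -> dset d))) : Prop :=
  suitable_levels T /\ forall l, lightface_Delta11 (level T l).

(* Main.v *)
Require Import Defs.
From mathcomp Require Import all_boot all_order all_algebra.
From mathcomp Require Import all_classical all_reals all_analysis.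
From mathcomp Require wochoice.
From mathcomp Require Import ring zify.

Set Implicit Arguments.
Unset Strict Implicit.
Unset Printing Implicit Defensive.

Import Order.TTheory GRing.Theory Num.Theory.

Local Open Scope classical_set_scope.

(** A letter of the tree is a function from [d] to [d]: a constant [a], allowed
    at position [j] when [a <= j], or the identity, allowed at position [j] only
    after the word [t j]. The words [t j] carry labels [lab j], and every node of
    the tree is, for every label, a prefix of some [t j] obtained by appending
    constants. At level [l.+1] the only new edge is [rcons (t l) id], which
    meets the copy of level [l] indexed by [a] in the coordinate [a] only; this
    gives one-sidedness and almost acyclicity.

    A point [x] of the body codes the set of the labels of its identity letters,
    and membership in this set is an open condition. Pulling back a complete
    [Sigma^0_xi] set of sets of labels gives a [Sigma^0_xi] subset of the body.
    Finer Polish topologies on the factors agree with the usual ones at generic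
    points; one can be generic by appending constants only, hence without
    creating labels. So, given continuous instructions [g] computing a set of
    labels, some point of the body is generic in each coordinate and codes exactly
    the set of labels that [g] computes on it. When [g] reduces the complement of
    a potential separating set, this point contradicts separation. *)

(** * The tree *)

Section Tree.
Variables (d : card_le_omega) (t : nat -> seq (dset d -> dset d)).
Local Notation D := (dset d).
Local Notation F := (D -> D).
Implicit Types (s : seq F) (v : F) (i : D).

(** The bound on [a] keeps the levels finite when [d] is omega; the identity is available after only
    one word of each length. *)
Definition allowed s v :=
  (exists2 a : D, val a <= size s & v = fun=> a) \/ (v = id /\ s = t (size s)).

Definition Tr : set (seq F) :=
  [set s | forall s1 v s2, s = s1 ++ v :: s2 -> allowed s1 v].

Definition col i s := [seq v i | v <- s].

Definition transpose l (x : D -> l.-tuple D) : seq F :=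
  [seq (fun i => tnth (x i) j) | j <- enum 'I_l].

Lemma Tr_nil : Tr [::].
Proof. by case. Qed.

Lemma Tr_catl s s' : Tr (s ++ s') -> Tr s.
Proof.
move=> Ts s1 v s2 es; apply: (Ts s1 v (s2 ++ s')).
by rewrite es -catA.
Qed.

Lemma Tr_rcons s v : Tr (rcons s v) <-> Tr s /\ allowed s v.
Proof.
split=> [Tsv|[Ts sv] s1 u s2].
  by split; [apply: (@Tr_catl s [:: v]); rewrite cats1|apply: (Tsv s v [::]); rewrite cats1].
elim/last_ind: s2 => [|s2 w _]; first by rewrite cats1 => /rcons_inj[<- <-].
by rewrite -rcons_cons -rcons_cat => /rcons_inj[/Ts].
Qed.

Lemma col_rcons i s v : col i (rcons s v) = rcons (col i s) (v i).
Proof. by rewrite /col map_rcons. Qed.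

Lemma size_transpose l (x : D -> l.-tuple D) : size (transpose x) = l.
Proof. by rewrite size_map size_enum_ord. Qed.

Lemma col_transpose l (x : D -> l.-tuple D) i : col i (transpose x) = x i.
Proof.
rewrite /col /transpose -map_comp.
by rewrite -[RHS](map_tnth_enum (x i)).
Qed.

Lemma transpose_inj l : injective (@transpose l).
Proof.
move=> x y exy; apply/funext => i; apply: val_inj.
by rewrite /= -!col_transpose exy.
Qed.

Lemma col_const_inj (a b i : D) s s' :
  col i (rcons s (fun=> a)) = col i (rcons s' (fun=> b)) -> a = b.
Proof. by rewrite !col_rcons => /rcons_inj[]. Qed.

(** Induction on the length. If the words differ before their last letter, the shorter words decide.
    Otherwise the last letters differ, and a shared coordinate leaves only a constant [a] against
    the identity, which agree at [a] alone. *)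
Lemma Tr_one_sided l s s' i j : size s = l -> size s' = l -> Tr s -> Tr s' ->
  s <> s' -> col i s = col i s' -> col j s = col j s' -> i = j.
Proof.
elim: l s s' => [|l IHl] s s'; first by move=> /size0nil-> /size0nil->.
case/lastP: s => // s v; case/lastP: s' => // s' v'; rewrite !size_rcons.
move=> [sl] [s'l] /Tr_rcons[Ts sv] /Tr_rcons[Ts' sv'] ne.
rewrite !col_rcons => /rcons_inj[ei vi] /rcons_inj[ej vj].
have [es|nes] := EM (s = s'); last exact: (IHl s s').
case: sv sv' ne vi vj => [[a _ ->]|[-> _]] [[b _ ->]|[-> _]] ne vi vj.
- by case: ne; rewrite es vi.
- by rewrite -vi -vj.
- by rewrite vi vj.
- by case: ne; rewrite es.
Qed.

Hypothesis D2 : exists i j : D, i <> j.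

(* The only element of level [l.+1] ending with [id] is [rcons (t l) id]; its
   two neighbours in a cycle end with the same constant [a], hence share with
   it the coordinate [a]. *)
Lemma Tr_cycle l (c : nat -> seq F) (L : nat) : 3 <= L ->
  (forall n, [/\ Tr (c n), size (c n) = l & exists i, col i (c n) = col i (c n.+1)]) ->
  (forall n, c (n + L) = c n) ->
  (forall m n, c m = c n -> m = n %[mod L]) ->
  exists (i : D) (k m n : nat), [/\ c k <> c m, c m <> c n, c k <> c n,
    col i (c k) = col i (c m) & col i (c m) = col i (c n)].
Proof.
move=> L3; elim: l c => [|l IHl] c cP cL c_inj.
  have : c 0 = c 1 by have [_ /size0nil-> _] := cP 0; have [_ /size0nil-> _] := cP 1.
  by move/c_inj; rewrite mod0n modn_small ?(ltn_trans _ L3).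
have /choice[sv svP] n : exists sv : seq F * F,
    [/\ c n = rcons sv.1 sv.2, Tr sv.1, size sv.1 = l & allowed sv.1 sv.2].
  have [+ + _] := cP n; case/lastP: (c n) => // s v /Tr_rcons[Ts sv].
  by rewrite size_rcons => -[sl]; exists (s, v).
(* If no vertex ends with the identity, adjacent vertices end with the same constant; deleting this
   common last letter gives a cycle one level lower. *)
have [[p vp]|nid] := EM (exists p, (sv p).2 = id); last first.
  have /choice[a aP] n : exists a : D, (sv n).2 = fun=> a.
    by have [_ _ _ [[a _ ?]|[? _]]] := svP n; [exists a|case: nid; exists n].
  have ca n : c n = rcons (sv n).1 (fun=> a n) by rewrite -aP; case: (svP n).
  have aS n : a n.+1 = a 0.
    elim: n => [|n <-]; [have [_ _ [i]] := cP 0|have [_ _ [i]] := cP n.+1];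
      by rewrite !ca => /col_const_inj.
  have a0 n : a n = a 0 by case: n.
  have c0 n : c n = rcons (sv n).1 (fun=> a 0) by rewrite ca a0.
  have s_inj m n : ((sv m).1 = (sv n).1) <-> (c m = c n).
    by rewrite !c0; split=> [->//|/rcons_inj[]].
  have [|||i [k [m [n [km mn kn ikm imn]]]]] := IHl (fun n => (sv n).1).
  - move=> n; have [_ Ts sl _] := svP n; split=> //.
    by have [_ _ [i]] := cP n; rewrite !c0 !col_rcons => /rcons_inj[ei]; exists i.
  - by move=> n; apply/s_inj.
  - by move=> m n /s_inj/c_inj.
  exists i, k, m, n; split; try by rewrite -s_inj.
    by rewrite !c0 !col_rcons ikm.
  by rewrite !c0 !col_rcons imn.
have end_id n : (sv n).2 = id -> c n = c p.
  have s_t k : (sv k).2 = id -> (sv k).1 = t l.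
    have [_ _ <- [[a _ ->] aid|[_ //]]] := svP k.
    have [i [j []]] := D2; have := congr1 (@^~ i) aid; have := congr1 (@^~ j) aid.
    by rewrite /= => <- <-.
  move=> vn; have [-> _ _ _] := svP n; have [-> _ _ _] := svP p.
  by rewrite vn vp !s_t.
(* Rotate the cycle so that its only vertex ending with the identity has index 0. *)
pose e n := c (n + p).
have eL n : e (n + L) = e n by rewrite /e addnAC cL.
have e_inj m n : e m = e n -> m = n %[mod L].
  by move/c_inj => /eqP; rewrite eqn_modDr => /eqP.
have e0_last : e L.-1.+1 = e 0 by rewrite prednK ?(ltn_trans _ L3)// -[L]add0n eL.
have /choice[a aP] n : exists a : D, 0 < n < L -> e n = rcons (sv (n + p)).1 (fun=> a).
  have [_ _ _ [[a _ va]|[/end_id cn _]]] := svP (n + p).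
    by exists a => _; rewrite /e -va; case: (svP (n + p)).
  have [i _] := D2; exists i => /andP[n0 nL].
  have /e_inj : e n = e 0 by rewrite /e cn.
  by rewrite mod0n modn_small// => n0'; rewrite n0' in n0.
have e_adj n : exists i, col i (e n) = col i (e n.+1).
  by have [_ _] := cP (n + p).
have a1 n : n.+1 < L -> a n.+1 = a 1.
  elim: n => [//|n IHn] nL; rewrite -IHn; last exact: ltnW.
  by have [i] := e_adj n.+1; rewrite !aP /= ?nL ?(ltnW nL)// => /col_const_inj.
have e0E : e 0 = rcons (sv p).1 id by rewrite /e add0n -vp; case: (svP p).
have L1 : L.-1 = L.-2.+1 by move: L3; clear; case: L => [|[|]].
have lt1L : 1 < L by exact: ltn_trans L3.
have LL : L.-1 < L by move: L3; clear; case: L.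
(* The vertex 0 with its neighbours 1 and [L.-1], distinct because [3 <= L]. The identity agrees
   with the constant [a 1] at the coordinate [a 1] only. *)
exists (a 1), (1 + p), (0 + p), (L.-1 + p); split.
- by move/(e_inj 1 0); rewrite mod0n modn_small ?lt1L.
- by move/(e_inj 0 L.-1); rewrite mod0n modn_small// L1.
- move/(e_inj 1 L.-1); rewrite !modn_small//.
  by move: L3; clear; case: L => [|[|[|]]].
- have [i] := e_adj 0; rewrite -/(e 0) -/(e 1) e0E (aP 1) ?lt1L//.
  by rewrite !col_rcons => /rcons_inj[E1 /= E2]; rewrite -E2 E1.
- have [i] := e_adj L.-1; rewrite -/(e 0) -/(e L.-1) e0_last e0E (aP L.-1); last first.
    by rewrite LL andbT L1.
  rewrite [in a L.-1]L1 a1; last by rewrite -L1.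
  by rewrite !col_rcons => /rcons_inj[E1 /= E2]; rewrite E2 E1.
Qed.

Lemma Tr_suitable : suitable_levels Tr.
Proof.
have finT l : finite_set [set s | Tr s /\ size s = l].
  elim: l => [|l IHl].
    by apply: (@sub_finite_set _ _ [set [::]]) => // s [_ /size0nil].
  pose V := [set v : F | v = id] `|` [set (fun=> a) | a in [set a : D | val a <= l]].
  have finV : finite_set V.
    rewrite finite_setU; split; first exact: finite_set1.
    apply: finite_image; apply: (@finite_preimage _ _ `I_l.+1 val) => //.
    by move=> x y _ _; apply: val_inj.
  apply: (@sub_finite_set _ _
      [set rcons s v | s in [set s | Tr s /\ size s = l] & v in V]).
    move=> s []; case/lastP: s => // s v /Tr_rcons[Ts sv]; rewrite size_rcons => -[sl].
    exists s => //; exists v => //; case: sv => [[a al ->]|[-> _]]; last by left.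
    by right; exists a => //=; rewrite -sl.
  exact: finite_image2.
move=> l; split.
- apply: (@sub_finite_set _ _ (@transpose l @^-1` [set s | Tr s /\ size s = l])).
    by move=> x Tx; split=> //; exact: size_transpose.
  by apply: finite_preimage => // x y _ _; exact: transpose_inj.
- move=> x y Tx Ty xy i j xi xj.
  apply: (@Tr_one_sided l (transpose x) (transpose y)) => //;
    rewrite ?size_transpose ?col_transpose ?xi ?xj //.
  by move/transpose_inj.
- move=> x L [L3 xE xL x_inj].
  have L0 : 0 < L by rewrite (ltn_trans _ L3).
  (* [Gcycle] only constrains the indices up to [L]; the periodic extension can be rotated. *)
  pose c n := transpose (x (n %% L)).
  have [|||i [k [m [n [km mn kn ikm imn]]]]] := @Tr_cycle l c L L3.
  - move=> n; have [Tx _ _ [i xi]] := xE (n %% L) (ltn_pmod n L0).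
    split; [exact: Tx|exact: size_transpose|exists i].
    rewrite !col_transpose xi modnS; case: ifP => // /dvdnP[q qE].
    suff -> : (n %% L).+1 = L by rewrite xL.
    have := ltn_pmod n L0; rewrite leq_eqVlt => /orP[/eqP//|nL].
    have : (n.+1 %% L) = (n %% L).+1 by rewrite -addn1 -modnDml addn1 modn_small.
    by rewrite qE modnMl.
  - by move=> n; rewrite /c modnDr.
  - by move=> m n /transpose_inj/x_inj; apply; rewrite ltn_mod.
  move: ikm imn; rewrite !col_transpose => /val_inj ikm /val_inj imn.
  (* The three vertices come in no particular order, while almost acyclicity asks for increasing
     indices. *)
  have ord (u v w : nat) : u < L -> v < L -> w < L -> u <> v -> v <> w -> u <> w ->
      x u i = x v i -> x v i = x w i -> exists i k m n,
      [/\ k < m, m < n, n < L, x k i = x m i & x m i = x n i].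
    move=> uL vL wL /eqP uv /eqP vw /eqP uw xuv xvw.
    wlog uv' : u v w uL vL wL uv vw uw xuv xvw / u < v => [H|].
      have [|vu] := ltnP u v; first exact: (H u v w).
      apply: (H v u w) => //; rewrite ?[v == u]eq_sym ?xuv //.
      by rewrite ltn_neqAle eq_sym uv.
    have [vw'|wv] := ltnP v w; first by exists i, u, v, w.
    have {}wv : w < v by rewrite ltn_neqAle eq_sym vw.
    have [uw'|wu] := ltnP u w; first by exists i, u, w, v; rewrite xuv xvw.
    have {}wu : w < u by rewrite ltn_neqAle eq_sym uw.
    by exists i, w, u, v; rewrite xuv xvw.
  by apply: (@ord (k %% L) (m %% L) (n %% L)); rewrite ?ltn_mod // => e;
    [apply: km|apply: mn|apply: kn]; rewrite /c e.
Qed.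

End Tree.

(** * Recursive functions and effective levels *)

Definition recursive2 (u : nat -> nat -> nat) : Prop :=
  recursive (fun t : 2.-tuple nat => u (tnth t ord0) (tnth t (lift ord0 ord0))).

Section Recursive.
Variable k : nat.
Implicit Types f g h : k.-tuple nat -> nat.

Lemma recursive_ext f g : recursive f -> f =1 g -> recursive g.
Proof. by move=> rf /funext <-. Qed.

Lemma recursive_comp1 (u : nat -> nat) f : recursive1 u -> recursive f ->
  recursive (fun t => u (f t)).
Proof.
move=> ru rf; apply: (recursive_ext (rec_comp ru (fun=> rf))) => t.
by rewrite /thead tnth_mktuple.
Qed.

Lemma recursive_comp2 (u : nat -> nat -> nat) f g :
  recursive2 u -> recursive f -> recursive g -> recursive (fun t => u (f t) (g t)).
Proof.
move=> ru rf rg.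
have rfg (i : 'I_2) : recursive (if i == ord0 then f else g) by case: ifP.
apply: (recursive_ext (rec_comp ru rfg)) => t.
by rewrite !tnth_mktuple.
Qed.

Lemma recursive_succ f : recursive f -> recursive (fun t => (f t).+1).
Proof. exact: (recursive_comp1 rec_succ). Qed.

Lemma recursive_const n : recursive (fun _ : k.-tuple nat => n).
Proof. by elim: n => [|n]; [exact: rec_zero|exact: recursive_succ]. Qed.

End Recursive.

Lemma recursive1_iteri (h : nat -> nat -> nat) (a : nat) :
  recursive2 h -> recursive1 (fun n => iteri n h a).
Proof.
move=> rh; apply: (recursive_ext (rec_prim (recursive_const 0 a) rh)) => t /=.
by congr (iteri _ _ _); apply/funext => n; apply/funext => r; rewrite !(tnth_nth 0).
Qed.

Lemma recursive2_iteri (h : nat -> nat -> nat) (b : nat -> nat) :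
  recursive2 h -> recursive1 b ->
  recursive2 (fun n p => iteri n (fun _ r => h r p) (b p)).
Proof.
move=> rh rb.
have rh' : recursive (fun t : 3.-tuple nat =>
    h (tnth t (lift ord0 ord0)) (tnth t (lift ord0 (lift ord0 ord0)))).
  exact: recursive_comp2 rh (rec_proj _) (rec_proj _).
apply: (recursive_ext (rec_prim rb rh')) => t /=.
have e : thead (behead_tuple t) = tnth t (lift ord0 ord0).
  by rewrite /thead !(tnth_nth 0) /= nth_behead.
rewrite e; congr (iteri _ _ _); apply/funext => n; apply/funext => r.
by rewrite -e /thead !(tnth_nth 0).
Qed.

Lemma recursive2_add : recursive2 addn.
Proof.
have := @recursive2_iteri (fun r _ => r.+1) id (recursive_succ (rec_proj _)) (rec_proj _).
by move/recursive_ext; apply => t; elim: (tnth t ord0) => //= n ->; rewrite addSn.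
Qed.

Lemma recursive2_mul : recursive2 muln.
Proof.
have := @recursive2_iteri addn (fun=> 0) recursive2_add (rec_zero _).
by move/recursive_ext; apply => t; elim: (tnth t ord0) => //= n ->; rewrite mulSn addnC.
Qed.

Lemma recursive1_pred : recursive1 predn.
Proof.
have := @recursive1_iteri (fun n _ => n) 0 (rec_proj _).
by move/recursive_ext; apply => t /=; case: (thead t).
Qed.

Lemma recursive2_sub : recursive2 subn.
Proof.
have r2 := @recursive2_iteri (fun r _ => r.-1) id
  (recursive_comp1 recursive1_pred (rec_proj _)) (rec_proj _).
have := recursive_comp2 r2 (rec_proj (lift ord0 ord0 : 'I_2)) (rec_proj (ord0 : 'I_2)).
move/recursive_ext; apply => t; elim: (tnth t (lift _ _)) => [|n /= ->]; first by rewrite subn0.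
by rewrite subnS.
Qed.

Lemma recursive1_exp2 : recursive1 (expn 2).
Proof.
have r2 : recursive2 (fun _ r => r + r).
  exact: recursive_comp2 recursive2_add (rec_proj _) (rec_proj _).
move: (recursive1_iteri 1 r2).
by move/recursive_ext; apply => t; elim: (thead t) => //= n ->; rewrite expnS mul2n addnn.
Qed.

(** Finite tables are recursive: a primitive recursion that ignores the previous value returns [f 0]
    at 0 and [f n.+1] at [n.+1]. *)
Lemma recursive1_eventually_const (f : nat -> nat) (N c : nat) :
  (forall n, N <= n -> f n = c) -> recursive1 f.
Proof.
elim: N f => [|N IHN] f fc.
  by apply: (recursive_ext (recursive_const 1 c)) => t; rewrite fc.
have rS : recursive1 (f \o S) by apply: IHN => n Nn; apply: fc.
have r2 : recursive2 (fun n _ => f n.+1) by exact: recursive_comp1 rS (rec_proj _).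
move: (recursive1_iteri (f 0) r2).
by move/recursive_ext; apply => t /=; case: (thead t).
Qed.

Lemma recursive1_mod l : 0 < l -> recursive1 (modn^~ l).
Proof.
move=> l0; pose u n := if n.+1 == l then 0 else if n < l then n.+1 else 0.
have ru : recursive1 u.
  by apply: (@recursive1_eventually_const u l 0) => n ln; rewrite /u ltnNge ln; case: ifP.
have r2 : recursive2 (fun _ r => u r) by exact: recursive_comp1 ru (rec_proj _).
move: (recursive1_iteri 0 r2).
move/recursive_ext; apply => t; elim: (thead t) => /= [|n ->]; first by rewrite mod0n.
rewrite -addn1 -modnDml addn1 /u ltn_pmod //; case: eqP => [->|/eqP ne].
  by rewrite modnn.
by rewrite [RHS]modn_small // ltn_neqAle ne ltn_pmod.
Qed.

Lemma recursive1_div l : 0 < l -> recursive1 (divn^~ l).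
Proof.
move=> l0; pose z n := if n is 0 then 1 else 0.
have rz : recursive1 z by apply: (@recursive1_eventually_const z 1 0) => -[].
have r2 : recursive2 (fun n r => r + z (n.+1 %% l)).
  apply: (recursive_comp2 recursive2_add); first exact: rec_proj.
  apply: (recursive_comp1 rz); apply: (recursive_comp1 (recursive1_mod l0)).
  exact: recursive_succ (rec_proj _).
move: (recursive1_iteri 0 r2).
move/recursive_ext; apply => t; elim: (thead t) => /= [|n ->]; first by rewrite div0n.
by rewrite divnS // addnC /dvdn; case: (_ %% _).
Qed.

(** The integer square root: the summand is 1 exactly when [m.+1] has reached the square of
    [r.+1]. *)
Definition nsqrt n := iteri n (fun m r => r + (1 - (r.+1 * r.+1 - m.+1))) 0.
(** The value lies between the squares of [a + b] and [(a + b).+1], so [nsqrt] decodes it. *)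
Definition upair a b := (a + b) * (a + b) + a.
Definition ufst n := n - nsqrt n * nsqrt n.
Definition usnd n := nsqrt n - ufst n.

Lemma nsqrtP n : nsqrt n * nsqrt n <= n < (nsqrt n).+1 * (nsqrt n).+1.
Proof.
elim: n => [//|n IHn]; rewrite /nsqrt /= -/(nsqrt n).
by move: (nsqrt n) IHn => r; case: (leqP (r.+1 * r.+1) n.+1); nia.
Qed.

Lemma nsqrt_upair a b : nsqrt (upair a b) = a + b.
Proof.
have := nsqrtP (upair a b); move: (nsqrt _) => r; rewrite /upair.
move: (a + b) (leq_addr b a) => s; nia.
Qed.

Lemma ufst_upair a b : ufst (upair a b) = a.
Proof. by rewrite /ufst nsqrt_upair /upair addKn. Qed.

Lemma usnd_upair a b : usnd (upair a b) = b.
Proof. by rewrite /usnd ufst_upair nsqrt_upair addKn. Qed.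

Lemma recursive1_nsqrt : recursive1 nsqrt.
Proof.
apply: recursive1_iteri; apply: (recursive_comp2 recursive2_add); first exact: rec_proj.
apply: (recursive_comp2 recursive2_sub); first exact: recursive_const.
apply: (recursive_comp2 recursive2_sub); last exact: recursive_succ (rec_proj _).
by apply: (recursive_comp2 recursive2_mul); exact: recursive_succ (rec_proj _).
Qed.

Lemma recursive1_ufst : recursive1 ufst.
Proof.
apply: (recursive_comp2 recursive2_sub); first exact: rec_proj.
by apply: (recursive_comp2 recursive2_mul);
  exact: recursive_comp1 recursive1_nsqrt (rec_proj _).
Qed.

Lemma recursive1_usnd : recursive1 usnd.
Proof.
apply: (recursive_comp2 recursive2_sub).
  exact: recursive_comp1 recursive1_nsqrt (rec_proj _).
exact: recursive_comp1 recursive1_ufst (rec_proj _).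
Qed.

Definition code2 a b := CodeSeq.code [:: a; b].

Lemma recursive2_code2 : recursive2 code2.
Proof.
have -> : code2 = fun a b => 2 ^ a * (2 ^ b + 2 ^ b).+1.
  by apply/funext => a; apply/funext => b; rewrite /code2 /= muln1 addnn.
have r2 (i : 'I_2) : recursive (fun t : 2.-tuple nat => 2 ^ tnth t i).
  exact: recursive_comp1 recursive1_exp2 (rec_proj _).
apply: (recursive_comp2 recursive2_mul) => //; apply: recursive_succ.
exact: (recursive_comp2 recursive2_add).
Qed.

(** Lets a quantifier over coordinates run over all numbers. For finite [d] the map is a finite
    table; for omega every number names a coordinate. *)
Lemma index_clamp (d : card_le_omega) (l : nat) (i0 : dset d) : val i0 = 0 -> 0 < l ->
  exists2 c, recursive1 c &
    (forall k, exists (i : dset d) (j : 'I_l), c k = val i * l + j) /\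
    forall (i : dset d) (j : 'I_l), c (val i * l + j) = val i * l + j.
Proof.
case: d i0 => [m|] i0 i0E l0; last first.
  exists id; first exact: rec_proj.
  split=> // k; exists (exist _ (k %/ l) isT), (Ordinal (ltn_pmod k l0)).
  by rewrite /= -divn_eq.
exists (fun k => if k < m * l then k else 0).
  by apply: (@recursive1_eventually_const _ (m * l) 0) => k; rewrite leqNgt => /negbTE->.
have lt_ml (i : dset (Finite_card m)) (j : 'I_l) : val i * l + j < m * l.
  rewrite (@leq_trans (val i * l + l)) ?ltn_add2l // -mulSnr leq_mul2r.
  by have im : val i < m := valP i; rewrite im orbT.
split=> [k|i j]; last by rewrite lt_ml.
case: ifP => km; last by exists i0, (Ordinal l0); rewrite i0E.
have im : below (Finite_card m) (k %/ l) by rewrite /= ltn_divLR.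
exists (exist _ (k %/ l) im : dset (Finite_card m)), (Ordinal (ltn_pmod k l0)).
by rewrite /= -divn_eq.
Qed.

(** * Lightface Delta^1_1 subsets of (d^l)^d *)

Section Delta11.
Variables (d : card_le_omega) (l : nat).
Local Notation D := (dset d).
Local Notation X := (D -> l.-tuple D).

Lemma graph_ofE (x : X) (i : D) (j : 'I_l) v :
  graph_of x (val i * l + j) v <-> v = val (tnth (x i) j).
Proof.
split=> [[i' [j' [e ->]]]|->]; last by exists i, j.
have l0 : 0 < l by exact: leq_ltn_trans (ltn_ord j).
have ei : i = i'.
  by apply: val_inj; have := congr1 (divn^~ l) e; rewrite /= !divnMDl // !divn_small ?addn0.
have ej : j = j' by apply: val_inj; rewrite /=; move: e; rewrite ei => /addnI.
by rewrite ei ej.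
Qed.

Lemma nbhd_X2 (x : X) a b : nbhd_X (code2 a b) x <-> graph_of x a b.
Proof. by rewrite /nbhd_X /= /code2 CodeSeq.codeK /=; split=> [[]|]. Qed.

Lemma nbhd_N2 (f : nat -> nat) a b : nbhd_N (code2 a b) f <-> f a = b.
Proof. by rewrite /nbhd_N /= /code2 CodeSeq.codeK /=; split=> [[]|]. Qed.

Lemma Delta11_level0 : l = 0 -> lightface_Delta11 [set: X].
Proof.
move=> l0; split.
  exists set0; split; last by apply/seteqP; split=> // x _; exists id.
  exists (fun=> code2 0 0), (fun=> 0); split; try exact: recursive_const.
  apply/seteqP; split=> // -[x b] [n _ [/= /nbhd_X2 [i [[j lj]]] _]].
  by exfalso; move: lj; rewrite l0.
exists setT; split; last by apply/seteqP; split=> x; [move=> /(_ I)|case=> b /(_ I)].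
exists (fun=> 0), (fun=> 0); split; try exact: recursive_const.
by apply/seteqP; split=> // z _; exists 0 => //.
Qed.

(** [x] is in [A] when, for some [r] stored in [b 0], no coordinate separates [x] from [pts r]; it
    is outside when some [b] gives, for every [r], a coordinate [b r] separating them. Both
    conditions on [x] and [b] have an effectively open negation. *)
Lemma Delta11_recursive_points (p : nat -> nat -> nat) (pts : nat -> X) (A : set X) :
  (exists i : D, val i = 0) -> 0 < l -> recursive2 p ->
  (forall r i j, val (tnth (pts r i) j) = p r (val i * l + j)) ->
  (forall x, A x <-> exists r, x = pts r) -> lightface_Delta11 A.
Proof.
move=> [i0 i0E] l0 rp ptsE AE.
have rfst := recursive1_ufst; have rsnd := recursive1_usnd.
have r1fst : recursive (fun t : 1.-tuple nat => ufst (thead t)).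
  exact: recursive_comp1 rfst (rec_proj _).
have r1snd : recursive (fun t : 1.-tuple nat => usnd (thead t)).
  exact: recursive_comp1 rsnd (rec_proj _).
have neq_pt (x y : X) : x <> y -> exists (i : D) (j : 'I_l), tnth (x i) j <> tnth (y i) j.
  move=> xy; apply: contrapT => nij; apply: xy; apply/funext => i; apply: eq_from_tnth => j.
  by apply: contrapT => xy; apply: nij; exists i, j.
split.
  (* [n] codes a row, a coordinate and a number [w]. The required value is [w], plus one once [w]
     reaches the entry of [p], so it runs through all values other than this entry. *)
  pose P : set (X * (nat -> nat)) :=
    \bigcup_n (@nbhd_X d l (code2 (ufst (usnd n)) (usnd (usnd n) +
        (1 - (p (ufst n) (ufst (usnd n)) - usnd (usnd n))))) `*`
      nbhd_N (code2 0 (ufst n))).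
  exists P; split.
    do 2 eexists; split; last by rewrite /P; reflexivity.
      apply: (recursive_comp2 recursive2_code2); first exact: recursive_comp1 rfst r1snd.
      apply: (recursive_comp2 recursive2_add); first exact: recursive_comp1 rsnd r1snd.
      apply: (recursive_comp2 recursive2_sub); first exact: recursive_const.
      apply: (recursive_comp2 recursive2_sub); last exact: recursive_comp1 rsnd r1snd.
      apply: (recursive_comp2 rp) => //; exact: recursive_comp1 rfst r1snd.
    by apply: (recursive_comp2 recursive2_code2) => //; exact: recursive_const.
  apply/seteqP; split=> [x /AE[r ->]|x [b nP]].
    exists (fun=> r) => -[n _ [/= /nbhd_X2[i [j [kE vE]]] /nbhd_N2 rE]].
    by move: vE; rewrite kE -rE ptsE; lia.
  apply/AE; exists (b 0); apply: contrapT => /neq_pt[i [j xij]]; apply: nP.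
  have {}xij : val (tnth (x i) j) <> p (b 0) (val i * l + j).
    by rewrite -ptsE => /val_inj.
  pose v := val (tnth (x i) j); pose q := p (b 0) (val i * l + j).
  exists (upair (b 0) (upair (val i * l + j) (if v < q then v else v.-1))) => //.
  split=> /=; rewrite !(ufst_upair, usnd_upair); last exact/nbhd_N2.
  apply/nbhd_X2/graph_ofE; rewrite -/v -/q; move: xij; rewrite -/v -/q.
  by case: ifP; lia.
have [c rc [cin cid]] := index_clamp i0E l0.
(* Without the clamp [c], a [b] whose values name no coordinate would escape [P] for every [x]. *)
pose P : set (X * (nat -> nat)) :=
  \bigcup_n (@nbhd_X d l (code2 (c (usnd n)) (p (ufst n) (c (usnd n)))) `*`
    nbhd_N (code2 (ufst n) (usnd n))).
exists P; split.
  do 2 eexists; split; last by rewrite /P; reflexivity.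
    apply: (recursive_comp2 recursive2_code2); first exact: recursive_comp1 rc r1snd.
    by apply: (recursive_comp2 rp) => //; exact: recursive_comp1 rc r1snd.
  exact: (recursive_comp2 recursive2_code2).
apply/seteqP; split=> [x nA|x [b nP] /AE[r xr]]; last first.
  apply: nP; exists (upair r (b r)) => //; split=> /=; rewrite ufst_upair usnd_upair.
    apply/nbhd_X2; have [i [j ->]] := cin (b r).
    by apply/graph_ofE; rewrite xr ptsE.
  exact/nbhd_N2.
have /choice[b bP] r : exists k, c k = k /\ ~ graph_of x k (p r k).
  have [|i [j xij]] := neq_pt x (pts r); first by move=> xr; apply: nA; apply/AE; exists r.
  exists (val i * l + j); split; first exact: cid.
  by move/graph_ofE; rewrite -ptsE => /val_inj/esym.
exists b => -[n _ [/= /nbhd_X2 + /nbhd_N2 bn]].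
by have [+ nG] := bP (ufst n); rewrite -bn => ->.
Qed.

End Delta11.

(** * The Borel hierarchy *)

Section WellOrder.
Variables (W : eqType) (le : rel W).
Hypothesis wo : wochoice.well_order le.

Lemma wo_min (P : W -> Prop) : (exists x, P x) ->
  exists z, P z /\ forall x, P x -> le z x.
Proof.
move=> [x Px]; have [|z [[/asboolP Pz lbz] _]] := wo (A := [pred x | `[< P x >]]).
  by exists x; apply/asboolP.
by exists z; split=> // y Py; apply/lbz/asboolP.
Qed.

Lemma wo_total x y : le x y \/ le y x.
Proof.
have [|z [[->|->] lez]] := @wo_min (fun z => z = x \/ z = y).
- by exists x; left.
- by left; apply: lez; right.
- by right; apply: lez; left.
Qed.

(** [well_order] provides unique minima: if [x] and [y] are below each other, both are minima of
    their pair. *)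
Lemma wo_anti x y : le x y -> le y x -> x = y.
Proof.
have le_refl z : le z z by case: (wo_total z z).
move=> lexy leyx.
have [|z [_ uz]] := wo (A := [pred z | (z == x) || (z == y)]).
  by exists x; rewrite inE eqxx.
have min t : t = x \/ t = y -> z = t.
  move=> txy; apply: uz; split; first by rewrite inE; case: txy => ->; rewrite eqxx ?orbT.
  by move=> u; rewrite inE => /orP[] /eqP->; case: txy => ->.
by rewrite -(min x) ?(min y) //; [right|left].
Qed.

Lemma wo_trans y x z : le x y -> le y z -> le x z.
Proof.
move=> lexy leyz.
have [|t [[->|[->|->]] let_]] := @wo_min (fun t => t = x \/ t = y \/ t = z).
- by exists x; left.
- by apply: let_; right; right.
- by rewrite (wo_anti lexy (let_ x _))//; left.
- by rewrite -(wo_anti leyz (let_ y _))//; right; left.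
Qed.

Lemma wlt_trans y x z : wlt le x y -> wlt le y z -> wlt le x z.
Proof.
move=> /andP[nxy lexy] /andP[nyz leyz]; rewrite /wlt (wo_trans lexy leyz) andbT.
by apply: contra nxy => /eqP xz; rewrite -xz in leyz; rewrite (wo_anti lexy leyz).
Qed.

Lemma wlt_total x y : [\/ x = y, wlt le x y | wlt le y x].
Proof.
rewrite /wlt; have [->|nxy] := eqVneq x y; first by constructor 1.
by have [->|->] := wo_total x y; [constructor 2|constructor 3].
Qed.

Lemma wlt_irr x : wlt le x x = false.
Proof. by rewrite /wlt eqxx. Qed.

Lemma wo_ind (P : W -> Prop) :
  (forall x, (forall y, wlt le y x -> P y) -> P x) -> forall x, P x.
Proof.
move=> IH x; apply: contrapT => nPx.
have [|z [nPz lez]] := @wo_min (fun z => ~ P z); first by exists x.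
apply: nPz; apply: IH => y /andP[nyz leyz]; apply: contrapT => /lez lezy.
by move/eqP: nyz; apply; apply: wo_anti.
Qed.

Lemma ord_eq1_ge1 x : ord_eq1 le x -> ord_ge1 le x.
Proof. by case=> y [yx _]; exists y. Qed.

Lemma ord_eq1_min x y : ord_eq1 le x -> ord_ge1 le y -> ~ wlt le y x.
Proof.
move=> [t [tx ut]] [z zy] yx; have := wlt_irr t.
by rewrite {1}(ut z (wlt_trans zy yx)) (ut y yx) zy.
Qed.

Lemma ord_one x : ord_ge1 le x -> ord_eq1 le x \/
  exists2 o, ord_eq1 le o & wlt le o x.
Proof.
move=> x1; have [|o [[y yo] leo]] := @wo_min (ord_ge1 le); first by exists x.
have o1 : ord_eq1 le o.
  exists y; split=> // y' y'o.
  have minor u v : wlt le u v -> wlt le v o -> False.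
    move=> uv /[dup] /andP[/eqP nvo levo] vo; apply: nvo.
    by apply: (wo_anti levo); apply: leo; exists u.
  by have [//|/minor/(_ y'o)|/minor/(_ yo)] := wlt_total y y'.
have [eox|ox|/(ord_eq1_min o1 x1)//] := wlt_total o x.
  by left; rewrite -eox.
by right; exists o.
Qed.

Section Sigma0Theory.
Variable T : topologicalType.
Implicit Types (x y : W) (A B : set T).
Local Notation Sg := (@Sigma0 W le T).

Lemma Sigma0_one x A : ord_eq1 le x -> Sg x A -> open A.
Proof.
move=> x1 SA; case: SA x1 => [//|{}x y {}A yx _ x1].
by have [y0 y0x] := yx 0; case: (ord_eq1_min x1 y0).
Qed.

Lemma Sigma0_gt1 x A : ~ ord_eq1 le x -> Sg x A ->
  exists (y : nat -> W) (B : nat -> set T),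
    [/\ forall n, ord_ge1 le (y n) /\ wlt le (y n) x,
        forall n, Sg (y n) (~` B n) & A = \bigcup_n B n].
Proof. by move=> + SA; case: SA => [//|{}x y {}A *]; exists y, A. Qed.

Lemma Pi0_Sigma0 y x A : ord_ge1 le y -> wlt le y x -> Sg y (~` A) -> Sg x A.
Proof.
move=> y1 yx SA; rewrite (_ : A = \bigcup_(n : nat) A); last first.
  by apply/seteqP; split=> [z Az|z []//]; exists 0.
exact: (@Sigma0_bigcup _ _ _ x (fun=> y) (fun=> A)).
Qed.

Lemma Sigma0T_0 x : ord_ge1 le x -> Sg x setT /\ Sg x set0.
Proof.
move=> /ord_one[x1|[u u1 ux]].
  by split; apply: Sigma0_open => //; [exact: openT|exact: open0].
have u0 := ord_eq1_ge1 u1; split; apply: (Pi0_Sigma0 u0 ux); apply: Sigma0_open => //.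
  by rewrite setCT; exact: open0.
by rewrite setC0; exact: openT.
Qed.

Lemma Sigma0_bigcupW x (A : nat -> set T) :
  (forall n, Sg x (A n)) -> Sg x (\bigcup_n A n).
Proof.
move=> SA; have [x1|x1] := EM (ord_eq1 le x).
  apply: Sigma0_open => //; apply: bigcup_open => n _.
  exact: Sigma0_one (SA n).
have /choice[y /choice[B yBP]] n := Sigma0_gt1 x1 (SA n).
pose f n := odflt (0, 0) (unpickle n : option (nat * nat)).
rewrite (_ : \bigcup_n A n = \bigcup_n B (f n).1 (f n).2).
  by apply: (@Sigma0_bigcup _ _ _ _ (fun n => y (f n).1 (f n).2)) => n;
    have [] := yBP (f n).1.
apply/seteqP; split=> z [n _].
  have [_ _ ->] := yBP n => -[m _ Bz]; exists (pickle (n, m)) => //.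
  by rewrite /f pickleK.
by move=> Bz; exists (f n).1 => //; have [_ _ ->] := yBP (f n).1; exists (f n).2.
Qed.

Lemma Sigma0U x A B : Sg x A -> Sg x B -> Sg x (A `|` B).
Proof.
move=> SA SB; rewrite (_ : _ `|` _ = \bigcup_n (if n is 0 then A else B)).
  by apply: Sigma0_bigcupW => -[].
apply/seteqP; split=> [z [Az|Bz]|z [[|n] _]]; [by exists 0|by exists 1|by left|by right].
Qed.

(* Holds in every zero-dimensional second countable space. *)
Hypothesis clopen_cover : forall A, open A ->
  exists2 B : nat -> set T, forall n, clopen (B n) & A = \bigcup_n B n.

(** If [y] is 1, the clopen pieces of an open set have open complements. If [y] is larger, the ranks
    of the pieces are below [y], hence below [x]. *)
Lemma Sigma0_mono y x A : ord_ge1 le y -> wlt le y x -> Sg y A -> Sg x A.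
Proof.
move=> y1 yx SA; have [yo|yo] := EM (ord_eq1 le y).
  have [B clB ->] := clopen_cover (Sigma0_one yo SA).
  apply: Sigma0_bigcupW => n; apply: (@Pi0_Sigma0 y) => //.
  by apply: Sigma0_open => //; have [_ /closed_openC] := clB n.
have [z [B [zP SB ->]]] := Sigma0_gt1 yo SA.
apply: (@Sigma0_bigcup _ _ _ _ z) => // n; have [z1 zy] := zP n.
by split=> //; exact: wlt_trans yx.
Qed.

(** Distribute over both unions; each pair of pieces is brought to the larger of the two ranks,
    where the complement of the intersection is a union. *)
Lemma Sigma0I x A B : Sg x A -> Sg x B -> Sg x (A `&` B).
Proof.
move=> SA SB; have [x1|x1] := EM (ord_eq1 le x).
  by apply: Sigma0_open => //; apply: openI; exact: (Sigma0_one x1).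
have [y [A' [yP SA' ->]]] := Sigma0_gt1 x1 SA.
have [z [B' [zP SB' ->]]] := Sigma0_gt1 x1 SB.
rewrite setI_bigcupl; apply: Sigma0_bigcupW => n.
rewrite setI_bigcupr; apply: Sigma0_bigcupW => m.
have [y1 yx] := yP n; have [z1 zx] := zP m.
have [yz|yz|zy] := wlt_total (y n) (z m).
- apply: (@Pi0_Sigma0 (z m)) => //; rewrite setCI; apply: Sigma0U => //.
  by rewrite -yz.
- apply: (@Pi0_Sigma0 (z m)) => //; rewrite setCI; apply: Sigma0U => //.
  exact: Sigma0_mono yz _.
- apply: (@Pi0_Sigma0 (y n)) => //; rewrite setCI; apply: Sigma0U => //.
  exact: Sigma0_mono zy _.
Qed.

Lemma Sigma0_bigcup_Delta0 x A : ord_ge1 le x -> Sg x A ->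
  exists2 B : nat -> set T,
    forall n, Sg x (B n) /\ Sg x (~` B n) & A = \bigcup_n B n.
Proof.
move=> xge1 SA; have [x1|x1] := EM (ord_eq1 le x).
  have [B clB ->] := clopen_cover (Sigma0_one x1 SA); exists B => // n.
  by have [oB /closed_openC cB] := clB n; split; apply: Sigma0_open.
have [y [B [yP SB ->]]] := Sigma0_gt1 x1 SA; exists B => // n.
have [y1 yx] := yP n; split; first exact: (Pi0_Sigma0 y1).
exact: Sigma0_mono yx _.
Qed.

Lemma Sigma0_bigcap x (B : nat -> set T) n : ord_ge1 le x ->
  (forall m, Sg x (B m)) -> Sg x [set z | forall m, m < n -> B m z].
Proof.
move=> x1 SB; elim: n => [|n IHn].
  by rewrite (_ : mkset _ = setT); [case: (Sigma0T_0 x1)|apply/seteqP].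
rewrite (_ : mkset _ = [set z | forall m, m < n -> B m z] `&` B n).
  exact: Sigma0I.
apply/seteqP; split=> [z Bz|z [Bz Bnz] m].
  by split=> [m mn|]; apply: Bz => //; exact: ltnW.
by rewrite ltnS leq_eqVlt => /orP[/eqP->//|]; exact: Bz.
Qed.

(** Write both sets as countable unions of ambiguous pieces and send a point to the side that
    catches it first; the bound [n.+1] gives the ties to [A']. The complements of earlier pieces
    stay in the class because the pieces are ambiguous. *)
Lemma Sigma0_reduction x A B : ord_ge1 le x -> Sg x A -> Sg x B ->
  exists A' B' : set T, [/\ Sg x A' /\ Sg x B', A' `<=` A, B' `<=` B,
    A' `&` B' = set0 & A `|` B `<=` A' `|` B'].
Proof.
move=> x1 /(Sigma0_bigcup_Delta0 x1)[a aP ->] /(Sigma0_bigcup_Delta0 x1)[b bP ->].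
exists (\bigcup_n (a n `&` [set z | forall m, m < n -> (~` b m) z])).
exists (\bigcup_n (b n `&` [set z | forall m, m < n.+1 -> (~` a m) z])).
split.
- by split; apply: Sigma0_bigcupW => n; apply: Sigma0I;
    by [case: (aP n)|case: (bP n)|apply: Sigma0_bigcap => // m; case: (aP m)
       |apply: Sigma0_bigcap => // m; case: (bP m)].
- by move=> z [n _ [az _]]; exists n.
- by move=> z [n _ [bz _]]; exists n.
- apply/seteqP; split=> // z [[n _ [az bz]] [m _ [bz' az']]].
  have [mn|nm] := ltnP m n; first exact: (bz m).
  exact: (az' n).
- move=> z abz; pose P n := `[< a n z \/ b n z >].
  have exP : exists n, P n.
    by case: abz => -[n _ ?]; exists n; apply/asboolP; [left|right].
  case: (ex_minnP exP) => n /asboolP abn minP.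
  have [an|nan] := EM (a n z).
    left; exists n => //; split=> // m mn bm.
    by have /minP : P m; [apply/asboolP; right|rewrite leqNgt mn].
  right; exists n => //; split; first by case: abn.
  move=> m; rewrite ltnS leq_eqVlt => /orP[/eqP->//|mn] am.
  by have /minP : P m; [apply/asboolP; left|rewrite leqNgt mn].
Qed.

End Sigma0Theory.
End WellOrder.

(** On [M], the topology is no finer than the one given by the approximations: some [r l z] forces
    membership in an open set. *)
Definition prefix_continuous (T : topologicalType) (Q : Type) (M : set T)
    (r : nat -> T -> Q) : Prop :=
  forall U, open U -> forall z, M z -> U z ->
  exists l, forall z', M z' -> r l z' = r l z -> U z'.

(* [C] is a complete set of its class: its preimages under positive open
   conditions are in the class, and every set of the class is such a preimage,
   by conditions that only look at the finite approximations [r l z]. *)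
Definition complete (W : eqType) (le : rel W) (x : W) (C : set (set nat)) : Prop :=
  [/\ exists E, C E, exists E, ~ C E,
      forall (T : topologicalType) (E : T -> set nat),
        (forall m, open [set z | E z m]) -> Sigma0 le x [set z | C (E z)]
    & forall (T : topologicalType) (Q : Type) (M : set T) (r : nat -> T -> Q),
        prefix_continuous M r -> forall A, Sigma0 le x A ->
        exists g : nat -> nat -> Q -> Prop, forall z, M z ->
          (A z <-> C [set m | exists l, g m l (r l z)])].

(** Induction on [x]. At 1, [C] asks that 0 be in [E]. Above 1, [E] is cut into sections indexed by
    pairs [(k, y)] with [y] below [x], and [C] asks that some section lie outside the complete set
    of rank [y]. A union of sets [B n] whose complements have rank [y n] is coded in the sections
    [(n, y n)]. *)
Lemma complete_exists (W : countType) (le : rel W) (x : W) :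
  wochoice.well_order le -> ord_ge1 le x -> exists C, complete le x C.
Proof.
move=> wo; elim/(wo_ind wo): x => x IHx xge1.
have [x1|x1] := EM (ord_eq1 le x).
  exists [set E | E 0]; split; [by exists setT|by exists set0| |].
    by move=> T E oE; apply: (Sigma0_open x1); exact: (oE 0).
  move=> T Q M r Mr A /(Sigma0_one wo x1) oA.
  exists (fun _ l q => forall z', M z' -> r l z' = q -> A z') => z Mz.
  split=> [Az|[l]]; last exact.
  by have [l Al] := Mr _ oA z Mz Az; exists l.
have /choice[C CP] y : exists C, ord_ge1 le y /\ wlt le y x -> complete le y C.
  have [[y1 yx]|ny] := EM (ord_ge1 le y /\ wlt le y x); last by exists set0.
  by have [C CP] := IHx y yx y1; exists C.
have [a a1 ax] : exists2 a, ord_ge1 le a & wlt le a x.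
  have [//|[a /ord_eq1_ge1 a1 ax]] := ord_one wo xge1; by exists a.
(* [E0] will make the new set nonempty; the sets [E1 y] fill the sections that must not put [E] into
   it. *)
have [E0 nE0] : exists E, ~ C a E by have [] := CP a (conj a1 ax).
have /choice[E1 E1P] y : exists E, ord_ge1 le y /\ wlt le y x -> C y E.
  have [yP|ny] := EM (ord_ge1 le y /\ wlt le y x); last by exists set0.
  by have [[E CE]] := CP y yP; exists E.
pose code k (y : W) m := pickle (k : nat, y, m : nat).
exists [set E | exists k y, (ord_ge1 le y /\ wlt le y x) /\
                            ~ C y [set m | E (code k y m)]]; split.
- exists [set n | exists2 m, E0 m & n = code 0 a m]; exists 0, a; split=> //.
  rewrite (_ : [set _ | _] = E0) //; apply/seteqP; split=> [m [m' ?]|m ?].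
    by move/(pcan_inj pickleK) => -[->].
  by exists m.
- exists [set n | exists k y m, E1 y m /\ n = code k y m] => -[k [y [yP]]].
  rewrite (_ : [set _ | _] = E1 y); first by move=> /(_ (E1P y yP)).
  apply/seteqP; split=> [m [k' [y' [m' [?]]]]|m ?].
    by move/(pcan_inj pickleK) => -[_ -> ->].
  by exists k, y, m.
- move=> T E oE.
  pose f n := if (unpickle n : option (nat * W)) is Some ky then
    if `[< ord_ge1 le ky.2 /\ wlt le ky.2 x >] then ky else (0, a) else (0, a).
  have fP n : ord_ge1 le (f n).2 /\ wlt le (f n).2 x.
    by rewrite /f; case: unpickle => [ky|//]; case: asboolP.
  rewrite (_ : mkset _ =
    \bigcup_n [set z | ~ C (f n).2 [set m | E z (code (f n).1 (f n).2 m)]]).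
    apply: (Sigma0_bigcup (y := fun n => (f n).2)) => // n.
    rewrite (_ : ~` _ = [set z | C (f n).2 [set m | E z (code (f n).1 (f n).2 m)]]).
      by have [_ _ + _] := CP _ (fP n); apply => m; apply: oE.
    by apply/seteqP; split=> z /=; [exact: contrapT|move=> ? []].
  apply/seteqP; split=> [z [k [y [yP nC]]]|z [n _ nC]].
    exists (pickle (k, y)) => //=; rewrite /f pickleK /=.
    by case: asboolP.
  by exists (f n).1, (f n).2; split.
- move=> T Q M r Mr A /(Sigma0_gt1 x1)[y [B [yP SB ->]]].
  have /choice[g gP] n : exists g : nat -> nat -> Q -> Prop, forall z, M z ->
      ((~` B n) z <-> C (y n) [set m | exists l, g m l (r l z)]).
    by have [_ _ _ +] := CP _ (yP n); apply.
  (* The section [(k, y k)] follows the instructions for the complement of [B k]; every other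
     section [(k, u)] is [E1 u]. *)
  exists (fun n l q => exists k u m, n = code k u m /\
    ((u = y k /\ g k m l q) \/ (u <> y k /\ E1 u m))) => z Mz.
  have eq1 k : [set m | exists l, exists k' u m', code k (y k) m = code k' u m' /\
     ((u = y k' /\ g k' m' l (r l z)) \/ (u <> y k' /\ E1 u m'))] =
     [set m | exists l, g k m l (r l z)].
    apply/seteqP; split=> m [l]; last by move=> gk; exists l, k, (y k), m; split => //; left.
    case=> k' [u [m' [/(pcan_inj pickleK)[<- <- <-]]]] [[_ ?]|[]//].
    by exists l.
  have eq2 k v : v <> y k ->
     [set m | exists l, exists k' u m', code k v m = code k' u m' /\
     ((u = y k' /\ g k' m' l (r l z)) \/ (u <> y k' /\ E1 u m'))] = E1 v.
    move=> vy; apply/seteqP; split=> m.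
      by case=> l [k' [u [m' [/(pcan_inj pickleK)[<- <- <-]]]]] [[//]|[]].
    by move=> Em; exists 0, k, v, m; split => //; right.
  split=> [[n _ Bn]|[k [v [vP]]]].
    exists n, (y n); split=> //; rewrite /= eq1.
    by move=> /(gP n z Mz).
  have [->|vy] := EM (v = y k); last by rewrite /= (eq2 k v vy) => /(_ (E1P v vP)).
  rewrite /= eq1 => nC; exists k => //; apply: contrapT => nB.
  by apply: nC; apply/gP.
Qed.

(** * Generic points *)

Lemma countable_enum (T : Type) (A : set T) (a : T) : countable A -> A a ->
  exists2 e : nat -> T, forall n, A (e n) & forall b, A b -> exists n, e n = b.
Proof.
move=> /countable_injP[f finj] Aa.
have /choice[e eP] n : exists b, A b /\ ((exists2 c, A c & f c = n) -> f b = n).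
  have [[c Ac fc]|nc] := EM (exists2 c, A c & f c = n); first by exists c.
  by exists a; split=> // -[c Ac fc]; case: nc; exists c.
exists e => [n|b Ab]; first by case: (eP n).
exists (f b); have [Ae fe] := eP (f b).
by apply: finj; rewrite ?inE //; apply: fe; exists b.
Qed.

Section Mkseq.
Variables (D : Type).
Implicit Types x y : nat -> D.

Lemma take_mkseq x l l' : l <= l' -> take l (mkseq x l') = mkseq x l.
Proof. by move=> ll'; rewrite /mkseq -map_take take_iota (minn_idPl ll'). Qed.

Lemma mkseqW x y l l' : l <= l' -> mkseq x l' = mkseq y l' -> mkseq x l = mkseq y l.
Proof. by move=> ll' e; rewrite -(take_mkseq _ ll') e take_mkseq. Qed.

Lemma mkseq_nthE x y l : mkseq x l = mkseq y l <-> forall j, j < l -> x j = y j.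
Proof.
split=> [e j jl|e]; last by apply/eq_in_map => j; rewrite mem_iota => /e.
by have := congr1 (fun s => nth (x j) s j) e; rewrite !nth_mkseq.
Qed.

End Mkseq.

(** * Baire category for sequences with admissible prefixes *)

Section Category.
Variables (D : countType) (adm : set (seq D)).
Implicit Types (x : nat -> D) (s t : seq D) (A : set (seq D)) (U : set (nat -> D)).

Lemma prefix_mkseq x l l' : l <= l' -> prefix (mkseq x l) (mkseq x l').
Proof. by move=> /(take_mkseq x) <-; exact: prefix_take. Qed.

Definition dense_in A := forall s, adm s -> exists t, [/\ adm t, prefix s t & A t].

Definition meets A x := exists l, adm (mkseq x l) /\ A (mkseq x l).

Definition dense_family (F : set (set (seq D))) := countable F /\ F `<=` dense_in.

Definition generic (F : set (set (seq D))) x :=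
  (forall n, exists2 l, n <= l & adm (mkseq x l)) /\ forall A, F A -> meets A x.

(** Meagerness inside the cylinder of [s], in terms of genericity: countably many dense sets of
    words leave no generic point of [U] there. *)
Definition meager_at U s := exists2 F, dense_family F &
  forall x, U x -> mkseq x (size s) = s -> ~ generic F x.

Definition heavy U : set (seq D) :=
  [set s | forall t, adm t -> prefix s t -> ~ meager_at U t].

Lemma dense_family_bigcup (I : countType) (P : set I) (F : I -> set (set (seq D))) :
  (forall i, P i -> dense_family (F i)) -> dense_family (\bigcup_(i in P) F i).
Proof.
move=> FP; split; first by apply: bigcup_countable => // i /FP[].
by move=> A [i /FP[_ Fd]] /Fd.
Qed.

Lemma dense_familyU F G : dense_family F -> dense_family G -> dense_family (F `|` G).
Proof.
move=> [cF dF] [cG dG]; split; last by move=> A [/dF|/dG].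
by rewrite -bigcup2E; apply: bigcup_countable => // -[|[|n]] _ /=; rewrite ?countable0.
Qed.

Lemma dense_family1 A : dense_in A -> dense_family [set A].
Proof. by move=> dA; split=> [|_ ->//]; exact: countable1. Qed.

Lemma generic_sub F G x : F `<=` G -> generic G x -> generic F x.
Proof. by move=> FG [cx Gx]; split=> // A /FG/Gx. Qed.

Lemma heavyW U s t : heavy U s -> prefix s t -> heavy U t.
Proof. by move=> hs st v av tv; apply: hs => //; exact: prefix_trans tv. Qed.

Lemma heavy_mem U s : adm s -> heavy U s -> exists2 x, U x & mkseq x (size s) = s.
Proof.
move=> as_ /(_ s as_ (prefix_refl s)) nm; apply: contrapT => nx; apply: nm.
exists set0; first by split=> //; exact: countable0.
by move=> x Ux xs; case: nx; exists x.
Qed.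

(** There are only countably many words, so the families obtained for each [s] can be united. *)
Lemma meager_family U : exists2 F, dense_family F &
  forall s x, meager_at U s -> generic F x -> U x -> mkseq x (size s) <> s.
Proof.
have /choice[F FP] s : exists F, meager_at U s -> dense_family F /\
    forall x, U x -> mkseq x (size s) = s -> ~ generic F x.
  have [[F dF FP]|nm] := EM (meager_at U s); first by exists F.
  by exists set0.
exists (\bigcup_(s in meager_at U) F s).
  by apply: dense_family_bigcup => s /FP[].
move=> s x ms gx Ux xs; have [_ /(_ x Ux xs)] := FP s ms; apply.
by apply: generic_sub gx => A FA; exists s.
Qed.

(** The words that are heavy or at which [U] is meager form a dense set. A generic point of [U]
    meets it, and cannot do so at a meager word. *)
Lemma generic_heavy U : exists2 F, dense_family F &
  forall x, generic F x -> U x -> meets (heavy U) x.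
Proof.
have [F dF FP] := meager_family U.
pose A := [set s | heavy U s \/ meager_at U s].
have dA : dense_in A.
  move=> s as_; have [hs|] := EM (heavy U s).
    by exists s; split; [|exact: prefix_refl|left].
  move/existsNP => [t /not_implyP[at_ /not_implyP[st /contrapT mt]]].
  by exists t; split=> //; right.
exists (F `|` [set A]); first by apply: dense_familyU => //; exact: dense_family1.
move=> x gx Ux; have [l [al [hl|ml]]] : meets A x by case: gx => _; apply; right.
  by exists l.
have := FP _ x ml _ Ux; rewrite size_mkseq => /(_ _ erefl); case.
by apply: generic_sub gx => B; left.
Qed.

(** Below a word heavy for [U] some word is heavy for a [V i]: otherwise each [V i] would be meager
    at densely many words below it, and countably many dense sets would make [U] meager there. *)
Lemma heavy_bigcup (I : countType) (P : set I) U (V : I -> set (nat -> D)) :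
  U `<=` \bigcup_(i in P) V i ->
  exists2 A, dense_in A & forall x, meets A x -> meets (heavy U) x ->
    exists2 i, P i & meets (heavy (V i)) x.
Proof.
move=> UV.
have dense_heavy s : adm s -> heavy U s ->
    exists t, [/\ adm t, prefix s t & exists2 i, P i & heavy (V i) t].
  move=> as_ hs; apply: contrapT => nt.
  apply: (hs s as_ (prefix_refl s)).
  have /choice[F FP] i : exists F, dense_family F /\
      forall s x, meager_at (V i) s -> generic F x -> V i x -> mkseq x (size s) <> s.
    by have [F] := meager_family (V i); exists F.
  (* Words incompatible with [s] are added to make [A i] dense everywhere, not only below [s]. *)
  pose A i := [set t | meager_at (V i) t \/ ~~ (prefix s t || prefix t s)].
  have dA i : P i -> dense_in (A i).
    move=> Pi; have meager_above t : adm t -> prefix s t ->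
        exists v, [/\ adm v, prefix t v & meager_at (V i) v].
      move=> at_ st.
      have /existsNP[v /not_implyP[av /not_implyP[tv /contrapT mv]]] : ~ heavy (V i) t.
        by move=> ht; apply: nt; exists t; split=> //; exists i.
      by exists v.
    move=> t at_; have [/orP[st|ts]|nst] := boolP (prefix s t || prefix t s).
    - by have [v [av tv mv]] := meager_above t at_ st; exists v; split=> //; left.
    - have [v [av sv mv]] := meager_above s as_ (prefix_refl s).
      by exists v; split=> //; [exact: prefix_trans sv|left].
    - by exists t; split=> //; [exact: prefix_refl|right].
  exists (\bigcup_(i in P) (F i `|` [set A i])).
    apply: dense_family_bigcup => i Pi; apply: dense_familyU; first by case: (FP i).
    exact/dense_family1/dA.
  move=> x /UV[i Pi Vx] xs gx.
  have [l [al Al]] : meets (A i) x by case: gx => _; apply; exists i => //; right.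
  have [_ /(_ (mkseq x l) x)] := FP i; rewrite size_mkseq; apply => //; last first.
    by apply: generic_sub gx => C FC; exists i => //; left.
  case: Al => // /negP[]; rewrite -xs.
  by have [/(prefix_mkseq x)->|/ltnW/(prefix_mkseq x)->] := leqP (size s) l; rewrite ?orbT.
(* The words with no extension heavy for [U] make [A] dense; a point with a heavy prefix has none of
   them as a prefix. *)
pose A := [set t | (exists2 i, P i & heavy (V i) t) \/
  forall v, adm v -> prefix t v -> ~ heavy U v].
exists A.
  move=> s as_; have [[v [av sv hv]]|nv] := EM (exists v, [/\ adm v, prefix s v & heavy U v]).
    have [t [at_ vt Vt]] := dense_heavy v av hv.
    by exists t; split=> //; [exact: prefix_trans vt|left].
  exists s; split=> //; [exact: prefix_refl|right=> v av sv hv].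
  by apply: nv; exists v.
move=> x [l [al [[i Pi hi]|nh]]] [l' [al' hl']]; first by exists i => //; exists l.
have [ll'|/ltnW l'l] := leqP l l'.
  by case: (nh _ al' (prefix_mkseq x ll')).
by case: (nh _ al (prefix_refl _)); exact: heavyW hl' (prefix_mkseq x l'l).
Qed.

Local Open Scope ring_scope.

(* On the generic points of a closed set, a finer Polish topology is no finer
   than the topology of prefixes. An open set [U] of the finer topology agrees
   there with the open set of the points having a prefix on which [U] is heavy:
   a point of the latter is the limit of a sequence which is Cauchy for the finer
   metric and runs through refining basic balls. *)
Lemma finer_polish_generic (R : realType) (tau : Topological (nat -> D)) :
  let Y : topologicalType := Topological.Pack tau in
  polish R Y -> (forall s, @open Y [set x | mkseq x (size s) = s]) ->
  exists2 F, dense_family F & forall U, @open Y U -> forall x, generic F x -> U x ->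
    exists l, forall y, generic F y -> mkseq y l = mkseq x l -> U y.
Proof.
move=> Y [[C cC dC] [m [opE compl]]] cyl; pose M : metricType R := Metric.Pack m.
have [[c0 Cc0]|nC] := EM (exists c, C c); last first.
  exists set0; first by split=> //; exact: countable0.
  move=> U oU x _ Ux; case: nC.
  by have [|c [_ Cc]] := dC U _ oU; [exists x|exists c].
have [e eC Ce] := countable_enum cC Cc0.
pose rad (n : nat) : R := n.+1%:R^-1.
have rad_gt0 n : 0 < rad n by rewrite invr_gt0 ltr0n.
have rad_small (eps : R) : 0 < eps -> exists n, rad n < eps.
  move=> eps0; have [n _ nP] := near_infty_natSinv_lt (PosNum eps0).
  by exists n; apply: (nP n) => /=.
have rad_anti n k : (n <= k)%N -> rad k <= rad n.
  by move=> nk; rewrite lef_pV2 ?posrE ?ltr0n// ler_nat.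
pose B (j : nat * nat) : set M := ball (e j.1 : M) (rad j.2).
(* The doubled radius keeps limits of points of [B j'] inside [B j]; the increasing indices send the
   radii to 0. *)
pose ref (j : nat * nat) := [set j' : nat * nat |
  (j.2 < j'.2)%N /\ ball (e j'.1 : M) (rad j'.2 + rad j'.2) `<=` B j].
have dense_ball (y : M) (r : R) : 0 < r -> exists k, ball y r (e k).
  move=> r0; have oB : @open M (ball y r)^°%classic by exact: open_interior.
  have [|c [yc Cc]] := dC _ _ ((opE _).1 oB).
    by exists y; apply: nbhsx_ballx.
  by have [k ek] := Ce c Cc; exists k; rewrite ek; exact: interior_subset yc.
have refine (y : M) (U : set M) n : nbhs y U -> exists j : nat * nat,
    [/\ (n < j.2)%N, ball (e j.1 : M) (rad j.2 + rad j.2) `<=` U & B j y].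
  rewrite -nbhs_ballE => -[eps /= eps0 epsU].
  have [|k0 k0P] := rad_small (eps / 3); first by rewrite divr_gt0.
  pose k := maxn k0 n.+1.
  have kP : rad k < eps / 3 by apply: le_lt_trans k0P; apply/rad_anti/leq_maxl.
  have [i yi] := dense_ball y (rad k) (rad_gt0 k).
  exists (i, k); split=> /=.
  - by rewrite /k leq_max leqnn orbT.
  - move=> z ez; apply: epsU; apply: (@le_ball _ _ _ (rad k + (rad k + rad k))).
      by rewrite (_ : eps = eps / 3 + (eps / 3 + eps / 3)); [rewrite !lerD ?ltW|field].
    exact: ball_triangle yi ez.
  - exact: ball_sym.
have ref_cover j : B j `<=` \bigcup_(j' in ref j) B j'.
  move=> y By; have oBy : nbhs y (B j).
    apply/nbhs_ballP; exists (rad j.2 - mdist (e j.1 : M) y) => /=.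
      by move: By; rewrite /B ballEmdist /= subr_gt0.
    move=> z; move: By; rewrite /B !ballEmdist /= => By yz.
    by rewrite (le_lt_trans (metric_triangle _ y _))// -ltrBrDl.
  by have [j' [jj' sub Bj']] := refine y (B j) j.2 oBy; exists j'.
have /choice[FA FAP] j : exists F, dense_family F /\
    forall x, generic F x -> B j x -> meets (heavy (B j)) x.
  by have [F] := generic_heavy (B j); exists F.
have /choice[AB ABP] j : exists A, dense_in A /\
    forall x, meets A x -> meets (heavy (B j)) x ->
    exists2 j', ref j j' & meets (heavy (B j')) x.
  by have [A] := heavy_bigcup (@ref_cover j); exists A.
pose F := \bigcup_(j in [set: nat * nat]) (FA j `|` [set AB j]).
have dF : dense_family F.
  apply: dense_family_bigcup => j _; apply: dense_familyU; first by case: (FAP j).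
  by apply: dense_family1; case: (ABP j).
have mem_heavy j x : generic F x -> B j x -> meets (heavy (B j)) x.
  move=> gx; have [_ + Bx] := FAP j; apply=> //.
  by apply: generic_sub gx => A FA_; exists j => //; left.
(* This converse of [mem_heavy] suffices: a heavy prefix of [x] then keeps generic points in a ball
   inside [U]. *)
suff heavy_B j x : generic F x -> meets (heavy (B j)) x -> B j x.
  exists F => // U oU x gx Ux.
  have [j [_ jU Bx]] : exists j : nat * nat,
      [/\ (0 < j.2)%N, ball (e j.1 : M) (rad j.2 + rad j.2) `<=` U & B j x].
    by apply: refine; apply: open_nbhs_nbhs; split=> //; exact/opE.
  have [l [al hl]] := mem_heavy j x gx Bx.
  exists l => y gy yx; apply: jU; apply: (@le_ball _ _ _ (rad j.2)).
    by rewrite lerDl ltW.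
  by apply: heavy_B => //; exists l; rewrite yx.
move=> gx hx; have [cx Fx] := gx.
have /choice[next nextP] j' : exists j'', meets (heavy (B j')) x ->
    ref j' j'' /\ meets (heavy (B j'')) x.
  have [hj|] := EM (meets (heavy (B j')) x); last by exists j'.
  have [_ /(_ x _ hj)[|j'' ? ?]] := ABP j'; last by exists j''.
  by apply: Fx; exists j' => //; right.
pose js n := iter n next j.
have hjs n : meets (heavy (B (js n))) x.
  by elim: n => [//|n /nextP[]].
have refjs n : ref (js n) (js n.+1) by case: (nextP _ (hjs n)).
have js_ge n : (n <= (js n).2)%N.
  by elim: n => // n IHn; case: (refjs n) => + _; exact: leq_ltn_trans.
have nested n k : (n <= k)%N -> B (js k) `<=` B (js n).
  move=> /subnK <-; elim: (k - n)%N => [//|i IHi]; rewrite addSn.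
  apply: subset_trans IHi; have [_] := refjs (i + n)%N.
  by apply: subset_trans; apply: le_ball; rewrite lerDl ltW.
(* Heaviness at a long prefix of [x] yields a point of [B (js n)] that agrees with [x] up to [n];
   these points form a Cauchy sequence. *)
have /choice[u uP] n : exists u, B (js n) u /\ mkseq u n = mkseq x n.
  have [l [al hl]] := hjs n; have [l' ll' al'] := cx (maxn l n).
  have pl : prefix (mkseq x l) (mkseq x l').
    by apply: prefix_mkseq; rewrite (leq_trans (leq_maxl l n)).
  have [u Bu] := heavy_mem al' (heavyW hl pl).
  rewrite size_mkseq => ul'; exists u; split=> //.
  by apply: mkseqW ul'; rewrite (leq_trans (leq_maxr l n)).
have uB n k : (n <= k)%N -> B (js n) (u k).
  by move=> nk; apply: (nested n k nk); case: (uP k).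
have [|y uy] := compl ((u : nat -> M) @ \oo).
  apply: cauchy_exP => eps /rad_small[n nP]; exists (e (js n).1).
  exists n => // k /= nk; apply: (@le_ball _ _ _ (rad (js n).2)); last exact: uB.
  by rewrite (le_trans (rad_anti _ _ (js_ge n)))// ltW.
(* Cylinders are open in [Y], so the limit has the same prefixes as [x]. *)
have yx : y = x.
  apply/funext => i; pose N := [set z : nat -> D | mkseq z i.+1 = mkseq y i.+1].
  have oN : @open Y N.
    by rewrite /N; have := cyl (mkseq (y : nat -> D) i.+1); rewrite size_mkseq.
  have /uy[k _ kP] : nbhs (y : M) N by apply: open_nbhs_nbhs; split=> //; exact/opE.
  have /= := kP (maxn k i.+1) (leq_maxl _ _); rewrite /N /=.
  have [_ /(mkseqW (leq_maxr k i.+1))->] := uP (maxn k i.+1).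
  by move=> /mkseq_nthE/(_ i (ltnSn i)).
rewrite -yx; have [_ +] := refjs 0%N; apply.
have /uy[k _ kP] := nbhsx_ballx (y : M) _ (rad_gt0 (js 1%N).2).
have yu := kP (maxn k 1) (leq_maxl _ _).
exact: ball_triangle (uB 1%N _ (leq_maxr k 1)) (ball_sym yu).
Qed.

End Category.

(** * Words of the tree and effectivity of the levels *)

Section TreeLetters.
Variables (d : card_le_omega) (t : nat -> seq (dset d -> dset d)).
Local Notation D := (dset d).
Local Notation F := (D -> D).
Implicit Types (s : seq F) (v : F) (i : D).

Lemma Tr_nth s j v : Tr t s -> j < size s -> allowed t (take j s) (nth v s j).
Proof.
move=> Ts js; apply: (Ts _ _ (drop j.+1 s)).
by rewrite -drop_nth // cat_take_drop.
Qed.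

Lemma Tr_consts s (r : seq D) : Tr t s ->
  (forall j b, j < size r -> val (nth b r j) <= size s + j) ->
  Tr t (s ++ [seq (fun=> a) | a <- r]).
Proof.
elim/last_ind: r => [|r a IHr] Ts rP; first by rewrite cats0.
rewrite map_rcons -rcons_cat; apply/Tr_rcons; split.
  apply: IHr => // j b jr; have := rP j b; rewrite nth_rcons jr; apply.
  by rewrite size_rcons ltnW.
left; exists a => //; rewrite size_cat size_map.
by have := rP (size r) a; rewrite nth_rcons ltnn eqxx; apply; rewrite size_rcons.
Qed.

Lemma Tr_nseq s n (i0 : D) : val i0 = 0 -> Tr t s -> Tr t (s ++ nseq n (fun=> i0)).
Proof.
move=> i0E Ts; have -> : nseq n (fun=> i0) = [seq (fun=> a) | a : D <- nseq n i0] :> seq F.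
  by rewrite map_nseq.
by apply: Tr_consts => // j b; rewrite size_nseq nth_nseq => ->; rewrite i0E.
Qed.

(** A level is a finite list of points whose entries are affine in the coordinate [i]: a constant is
    [a + 0 * i], the identity is [0 + 1 * i]. The coefficients form finite tables, so the points are
    uniformly recursive even for infinite [d]. *)
Lemma level_Delta11 (i0 : D) (l : nat) : val i0 = 0 -> finite_set (level (Tr t) l) ->
  lightface_Delta11 (level (Tr t) l).
Proof.
move=> i0E finA; have [l0|l0] := posnP l.
  rewrite (_ : level _ _ = setT); first exact: Delta11_level0.
  apply/seteqP; split=> // x _.
  have e : transpose x = [::] by apply: size0nil; rewrite size_transpose.
  by rewrite /level /= -/(transpose _) e; exact: Tr_nil.
have [S AS] := (finite_seqP _).1 finA.
have A0 : level (Tr t) l (fun=> [tuple i0 | _ < l]).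
  suff e : transpose (fun=> [tuple i0 | _ < l]) = [::] ++ nseq l (fun=> i0).
    by rewrite /level /= -/(transpose _) e; exact/Tr_nseq/Tr_nil.
  rewrite -[in RHS](size_enum_ord l) /transpose /=.
  elim: (enum 'I_l) => //= j q ->; congr (_ :: _).
  by apply/funext => i; rewrite tnth_mktuple.
pose N := size S.
have N0 : 0 < N.
  by move: A0; rewrite AS /N; case: (S).
pose pt r := nth (fun=> [tuple i0 | _ < l]) S r.
have Apt r : r < N -> level (Tr t) l (pt r) by rewrite AS => rN; exact: mem_nth.
have /choice[ab abP] x : exists ab : 'I_l -> nat * nat, level (Tr t) l x ->
    forall i j, val (tnth (x i) j) = (ab j).1 + (ab j).2 * val i.
  have [Ax|] := EM (level (Tr t) l x); last by exists (fun=> (0, 0)).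
  suff /choice[ab abP] j : exists ab : nat * nat, forall i,
      val (tnth (x i) j) = ab.1 + ab.2 * val i by exists ab.
  have jl : j < size (transpose x) by rewrite size_transpose.
  have := Tr_nth id Ax jl; rewrite (nth_map j) ?size_enum_ord // nth_ord_enum.
  case=> [[a _ e]|[e _]]; [exists (val a, 0)|exists (0, 1)] => i;
    rewrite -[tnth _ _]/((fun i => tnth (x i) j) i) e /= ?mul0n ?addn0 //.
  by rewrite mul1n.
pose tab (f : nat * nat -> nat) n :=
  if n < N * l then f (ab (pt (n %/ l)) (Ordinal (ltn_pmod n l0))) else 0.
have rtab f : recursive1 (tab f).
  by apply: (@recursive1_eventually_const _ (N * l) 0) => n; rewrite /tab leqNgt => /negbTE->.
pose row r := minn r N.-1 * l.
have rrow : recursive1 row.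
  apply: (@recursive1_eventually_const _ N.-1 (N.-1 * l)) => n Nn.
  by rewrite /row (minn_idPr Nn).
pose p r k := tab fst (row r + k %% l) + tab snd (row r + k %% l) * (k %/ l).
apply: (@Delta11_recursive_points _ _ p (fun r => pt (minn r N.-1))) => //.
- by exists i0.
- have ridx : recursive2 (fun r k => row r + k %% l).
    apply: (recursive_comp2 recursive2_add); first exact: recursive_comp1 rrow (rec_proj _).
    exact: recursive_comp1 (recursive1_mod l0) (rec_proj _).
  apply: (recursive_comp2 recursive2_add); first exact: recursive_comp1 (rtab fst) ridx.
  apply: (recursive_comp2 recursive2_mul); first exact: recursive_comp1 (rtab snd) ridx.
  exact: recursive_comp1 (recursive1_div l0) (rec_proj _).
- move=> r i j; have rN : minn r N.-1 < N by rewrite gtn_min prednK // leqnn orbT.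
  rewrite (abP _ (Apt _ rN)) /p modnMDl divnMDl // modn_small // divn_small // addn0.
  have lt_tab : row r + j < N * l.
    rewrite /row (@leq_trans (minn r N.-1 * l + l)) ?ltn_add2l // -mulSnr.
    by rewrite leq_mul2r rN orbT.
  have idx : ab (pt ((row r + j) %/ l)) (Ordinal (ltn_pmod (row r + j) l0)) =
      ab (pt (minn r N.-1)) j.
    rewrite /row divnMDl // divn_small // addn0; congr (ab _ _); apply: val_inj => /=.
    by rewrite modnMDl modn_small.
  by rewrite /tab lt_tab idx.
- move=> x; rewrite AS /=; split=> [xS|[r ->]].
    exists (index x S); rewrite (minn_idPl _); first by rewrite /pt nth_index.
    by rewrite -ltnS prednK // index_mem.
  by apply: mem_nth; rewrite gtn_min prednK // leqnn orbT.
Qed.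

End TreeLetters.

Lemma repeating_enum (A : countType) (a0 : A) :
  exists e : nat -> A, forall a N, exists2 n, N <= n & e n = a.
Proof.
exists (fun n => odflt a0 (unpickle (logn 2 n))) => a N.
exists (2 ^ pickle a * N.*2.+1).
  by rewrite (leq_trans _ (leq_pmull _ _)) ?expn_gt0 // -addnn; lia.
by rewrite lognM ?expn_gt0 // pfactorK // lognE /= dvdn2 /= odd_double addn0 pickleK.
Qed.

(** Nodes are finite words over a countable alphabet, so all pairs of a word and a label can be
    listed, each infinitely often. The word listed at [k] is padded with [i0] up to length [k], and
    a given node recurs at some [k] beyond its own length. *)
Lemma dense_words (d : card_le_omega) (i0 : dset d) : exists t lab,
  forall (s : seq (dset d -> dset d)) (m : nat), Tr t s ->
  exists k, [/\ size s <= k, t k = s ++ nseq (k - size s) (fun=> i0) & lab k = m].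
Proof.
pose A : countType := {n | below d n}.
pose letter (o : option A) : dset d -> dset d := if o is Some a then fun=> a else id.
have [e eP] := @repeating_enum (seq (option A) * nat)%type ([::], 0).
pose t k := let w := [seq letter x | x <- (e k).1] in w ++ nseq (k - size w) (fun=> i0).
exists t, (fun k => (e k).2) => s m Ts.
have [w ws] : exists w, s = [seq letter x | x <- w].
  elim/last_ind: s Ts => [|s v IHs]; first by exists [::].
  move=> /Tr_rcons[/IHs[w ->] [[a _ ->]|[-> _]]].
    by exists (rcons w (Some a)); rewrite map_rcons.
  by exists (rcons w None); rewrite map_rcons.
have [k sk ek] := eP (w, m) (size s).
by exists k; rewrite /t ek /= -ws.
Qed.

(** * Diagonalization *)

Section Diagonal.
Variables (d : card_le_omega) (i0 i1 : dset d).
Hypotheses (i0E : val i0 = 0) (i1E : val i1 = 1).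
Variables (t : nat -> seq (dset d -> dset d)) (lab : nat -> nat).
Hypothesis t_dense : forall s m, Tr t s ->
  exists k, [/\ size s <= k, t k = s ++ nseq (k - size s) (fun=> i0) & lab k = m].

Local Notation A := {n | below d n}.
Local Notation D := (dset d).
Local Notation F := (D -> D).
Implicit Types (s : seq F) (v : F) (i : D) (x : D -> nat -> D).

Definition rows x (l : nat) : seq F := mkseq (fun j i => x i j) l.

(** A constant at position [j] is at most [j], but an identity letter puts [i] itself in column [i],
    hence a bound only from position [i] on. Beyond it, constants realise every admissible
    extension. *)
Definition adm i : set (seq A) :=
  [set s | val i <= size s /\
           forall j b, val i <= j < size s -> val (nth b s j) <= j].

Lemma i01 : i0 <> i1.
Proof. by move=> e; move: i1E; rewrite -e i0E. Qed.

Lemma allowed_eq s s' v v' : allowed t s v -> allowed t s' v' ->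
  v i0 = v' i0 -> v i1 = v' i1 -> v = v'.
Proof.
move=> [[a _ ->]|[-> _]] [[b _ ->]|[-> _]] //= e0 e1; first by rewrite e0.
  by case: i01; rewrite -e0 e1.
by case: i01; rewrite e0 -e1.
Qed.

Lemma const_id (a : D) : (fun=> a) <> id :> F.
Proof.
move=> e; have e0 : a = i0 := congr1 (@^~ i0) e; have e1 : a = i1 := congr1 (@^~ i1) e.
by apply: i01; rewrite -e0 -e1.
Qed.

Lemma allowed_id s v : allowed t s v -> v i0 <> v i1 <-> v = id.
Proof.
move=> [[a _ ->]|[-> _]]; split=> //; first by move/const_id.
by move=> _; exact: i01.
Qed.

Lemma Tr_adm i s : Tr t s -> val i <= size s -> adm i (col i s).
Proof.
move=> Ts is_; split; first by rewrite size_map.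
move=> j b; rewrite size_map => /andP[ij js]; rewrite (nth_map id) //.
case: (Tr_nth id Ts js) => [[a + ->]|[-> _]] //.
by rewrite size_take js.
Qed.

Definition step (i : D) (U : set (seq A)) (m : nat) (b : Prop) s s' :=
  [/\ Tr t s', exists2 z, s' = s ++ z & 0 < size z,
      exists2 l, l <= size s' & adm i (col i (take l s')) /\ U (col i (take l s')),
      b -> exists j, [/\ j < size s', nth id s' j = id & lab j = m]
    & forall j, size s <= j < size s' -> nth id s' j = id -> b /\ lab j = m].

(** Pad until column [i] is admissible, then extend it into [U] by constants, which create no label.
    If [b] holds, continue to some [t k] labelled [m] and append the identity. *)
Lemma step_exists i U m b s : dense_in (adm i) U -> Tr t s ->
  exists s', step i U m b s s'.
Proof.
move=> dU Ts; pose s1 := s ++ nseq (val i) (fun=> i0).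
have Ts1 : Tr t s1 by exact: Tr_nseq.
have is1 : val i <= size s1 by rewrite size_cat size_nseq leq_addl.
have szc : @size A (col i s1) = size s1 by exact: size_map.
have [u [[iu au] /prefixP[r ur] Uu]] := dU _ (Tr_adm Ts1 is1).
have szu : size u = size s1 + size r.
  by rewrite ur size_cat; congr (_ + _); exact: size_map.
pose s2 := s1 ++ [seq (fun=> a) | a : D <- r].
have Ts2 : Tr t s2.
  apply: Tr_consts => // j c jr.
  have <- : nth c u (size s1 + j) = nth c r j.
    by rewrite ur nth_cat szc ltnNge leq_addr /= addKn.
  apply: au; rewrite szu ltn_add2l jr andbT.
  by rewrite (leq_trans is1) ?leq_addr.
have col2 : col i s2 = u.
  by rewrite ur /col /s2 map_cat -map_comp; congr (_ ++ _); rewrite -[RHS]map_id.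
have const2 n j : size s <= j < size s2 + n ->
    nth id (s2 ++ nseq n (fun=> i0)) j <> id.
  move=> /andP[sj js]; suff [a ->] : exists a : D,
    nth id (s2 ++ nseq n (fun=> i0)) j = fun=> a by exact: const_id.
  pose r' := nseq (val i) i0 ++ r ++ nseq n i0.
  have -> : s2 ++ nseq n (fun=> i0) = s ++ [seq (fun=> a) | a : D <- r'].
    by rewrite /s2 /s1 !map_cat !map_nseq !catA.
  rewrite nth_cat ltnNge sj /= (nth_map i0); first by eexists.
  rewrite /r' !size_cat !size_nseq ltn_subLR //; apply: leq_trans js _.
  by rewrite /s2 /s1 !size_cat size_map size_nseq !addnA.
have sz2 : size s <= size s2 by rewrite /s2 /s1 !size_cat -addnA leq_addr.
have pre2 z : exists2 z', s2 ++ rcons z id = s ++ z' & 0 < size z'.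
  exists (nseq (val i) (fun=> i0) ++ [seq (fun=> a) | a : D <- r] ++ rcons z id).
    by rewrite /s2 /s1 -!catA.
  by rewrite !size_cat size_rcons !addnS.
have [bT|nb] := EM b.
  have [k [sk tk labk]] := t_dense m Ts2.
  exists (rcons (t k) id); rewrite tk.
  have szk : size (s2 ++ nseq (k - size s2) (fun=> i0)) = k.
    by rewrite size_cat size_nseq subnKC.
  split.
  - apply/Tr_rcons; split; first exact: Tr_nseq.
    by right; split=> //; rewrite szk.
  - by rewrite rcons_cat; exact: pre2.
  - exists (size s2); first by rewrite size_rcons szk ltnW.
    rewrite rcons_cat take_size_cat // col2.
    by split; [exact: (conj iu au)|].
  - by move=> _; exists k; rewrite size_rcons szk nth_rcons szk ltnn eqxx.
  - move=> j; rewrite size_rcons szk ltnS => /andP[sj]; rewrite leq_eqVlt.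
    move=> /orP[/eqP->//|jk]; rewrite nth_rcons szk jk => /const2 [].
    by rewrite sj subnKC.
exists (s2 ++ [:: fun=> i0]); split.
- exact: (@Tr_nseq _ _ _ 1).
- exists (nseq (val i) (fun=> i0) ++ [seq (fun=> a) | a : D <- r] ++ [:: fun=> i0]).
    by rewrite /s2 /s1 -!catA.
  by rewrite !size_cat /= !addnS.
- exists (size s2); first by rewrite size_cat leq_addr.
  rewrite take_size_cat // col2.
  by split; [exact: (conj iu au)|].
- by [].
- move=> j; rewrite size_cat => js jid; exfalso.
  exact: (const2 1 j js).
Qed.

Lemma rows_take x (S : seq F) l : (forall j, j < l -> nth id S j = x^~ j) ->
  l <= size S -> rows x l = take l S.
Proof.
move=> Sx lS; apply: (@eq_from_nth _ id); first by rewrite size_mkseq size_take_min (minn_idPl lS).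
by rewrite size_mkseq => j jl; rewrite nth_mkseq // nth_take // Sx.
Qed.

(** Each pair of a coordinate and a dense set gets a stage, and each label [m] gets infinitely many.
    A stage for [m] writes an identity letter only if [g] has accepted [m] on a prefix already
    built, and then ensures the label. The limit thus codes the set that [g] computes on it. *)
Lemma diagonal (g : nat -> nat -> seq F -> Prop) (fam : D -> set (set (seq A))) :
  (forall i, dense_family (adm i) (fam i)) ->
  exists x, [/\ forall l, Tr t (rows x l), forall i, generic (adm i) (fam i) (x i)
    & forall m, (exists2 j, lab j = m & x i0 j <> x i1 j) <->
                exists l, g m l (rows x l)].
Proof.
move=> famP.
pose P := [set iU : A * set (seq A) | (fam iU.1 `|` [set setT]) iU.2].
have [rq rqP rqS] : exists2 rq : nat -> A * set (seq A), forall n, P (rq n) &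
    forall iU, P iU -> exists n, rq n = iU.
  apply: (@countable_enum _ P (i0, setT)); last by right.
  rewrite (_ : P = \bigcup_(i in [set: A]) ((fun U => (i, U)) @` (fam i `|` [set setT]))).
    apply: bigcup_countable => // i _; apply: sub_countable (card_image_le _ _) _.
    rewrite -bigcup2E; apply: bigcup_countable => // -[|[|n]] _ /=.
    - by case: (famP i).
    - exact: countable1.
    - exact: countable0.
  apply/seteqP; split=> [[i U] PU|[i U] [i' _ [U' PU [<- <-]]]] //.
  by exists i => //; exists U.
have rq_dense n : dense_in (adm (rq n).1) (rq n).2.
  have [/(proj2 (famP _))//|->] := rqP n.
  by move=> s as_; exists s; split=> //; exact: prefix_refl.
have [ms msP] := repeating_enum 0.
pose b n s := exists2 l, l <= size s & g (ms n) l (take l s).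
have /choice[next nextP] ns : exists s', Tr t ns.2 ->
    step (rq ns.1).1 (rq ns.1).2 (ms ns.1) (b ns.1 ns.2) ns.2 s'.
  have [T2|] := EM (Tr t ns.2); last by exists [::].
  have [s'] := step_exists (ms ns.1) (b ns.1 ns.2) (rq_dense ns.1) T2.
  by exists s'.
pose S := fix S n := if n is n'.+1 then next (n', S n') else [::].
have TS n : Tr t (S n).
  by elim: n => [|n /(nextP (n, S n))[]//]; exact: Tr_nil.
have stepS n : step (rq n).1 (rq n).2 (ms n) (b n (S n)) (S n) (S n.+1).
  exact: nextP (n, S n) (TS n).
have sizeS n : n <= size (S n).
  elim: n => // n IHn; have [_ [z Sz z0] _ _ _] := stepS n.
  by rewrite Sz size_cat -addn1 leq_add.
have preS n k : exists z, S (n + k) = S n ++ z.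
  elim: k => [|k [z Sz]]; first by exists [::]; rewrite addn0 cats0.
  rewrite addnS; have [_ [z' -> _] _ _ _] := stepS (n + k).
  by exists (z ++ z'); rewrite Sz catA.
pose x (i : D) j := nth id (S j.+1) j i.
have Sx n j : j < size (S n) -> nth id (S n) j = x^~ j.
  move=> jn; rewrite /x.
  have [nj|jn'] := leqP n j.+1.
    by have [z] := preS n (j.+1 - n); rewrite subnKC // => ->; rewrite nth_cat jn.
  have [z] := preS j.+1 (n - j.+1); rewrite subnKC ?(ltnW jn') // => ->.
  by rewrite nth_cat (leq_trans _ (sizeS j.+1)).
have rowsS n l : l <= size (S n) -> rows x l = take l (S n).
  by move=> ln; apply: rows_take => // j jl; apply: Sx; exact: leq_trans ln.
have Tx l : Tr t (rows x l).
  rewrite (rowsS l) //; apply: (@Tr_catl _ t _ (drop l (S l))).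
  by rewrite cat_take_drop.
have colx i l : col i (rows x l) = mkseq (x i) l.
  by rewrite /col /rows /mkseq -map_comp.
exists x; split=> //.
- move=> i; split=> [n|U fU].
    exists (maxn n (val i)); rewrite ?leq_maxl // -colx; apply: Tr_adm => //.
    by rewrite size_mkseq leq_maxr.
  have [|n rqn] := rqS (i, U); first by left.
  have [_ _ [l ln] + _ _] := stepS n; rewrite rqn /= -(rowsS n.+1) // colx.
  by exists l.
- move=> m; split=> [[j labj xj]|[l gl]].
    have {}xj : x^~ j = id.
      have jT : j < size (rows x j.+1) by rewrite size_mkseq.
      have := Tr_nth id (Tx j.+1) jT; rewrite nth_mkseq //.
      by move=> /allowed_id[+ _]; apply.
    (* The first stage that reaches position [j] wrote its letter, so an identity there certifies
       the condition [b] of that stage. *)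
    have exn : exists n, j < size (S n) by exists j.+1; exact: sizeS.
    case: (ex_minnP exn) => -[//|n] jn minn; have [_ _ _ _ /(_ j)] := stepS n.
    rewrite jn andbT Sx // labj => /(_ _ xj)[|[l ln gl] ->].
      by rewrite leqNgt; apply/negP => /minn; rewrite ltnn.
    by exists l; rewrite (rowsS n).
  have [n ln msn] := msP m l.
  have lS : l <= size (S n) by exact: leq_trans ln (sizeS n).
  have [_ _ _ idS _] := stepS n; have [|j [jn jid labj]] := idS.
    by exists l; rewrite // msn -rowsS.
  exists j; first by rewrite labj.
  rewrite -[x i0 j]/((x^~ j) i0) -[x i1 j]/((x^~ j) i1) -(Sx n.+1) // jid.
  exact: i01.
Qed.

End Diagonal.

(** * Topology of the body *)

(** The sets containing, for some [l], all points of [M] with the approximation [r l z] form a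
    filter. It converges to [z] because it does so in each coordinate. *)
Lemma prefix_continuous_prod (I : Type) (X : I -> topologicalType) (Q : Type)
    (M : set (prod_topology X)) (r : nat -> prod_topology X -> Q) :
  (forall l l' z z', l <= l' -> r l' z' = r l' z -> r l z' = r l z) ->
  (forall i (U : set (X i)), open U -> forall z, M z -> U (z i) ->
     exists l, forall z', M z' -> r l z' = r l z -> U (z' i)) ->
  prefix_continuous M r.
Proof.
move=> rW rM U oU z Mz Uz.
pose G : set_system (prod_topology X) :=
  [set V | exists l, forall z', M z' -> r l z' = r l z -> V z'].
have GF : Filter G.
  split=> [|V V' [l lV] [l' lV']|V V' VV' [l lV]]; first by exists 0.
    exists (maxn l l') => z' Mz' e; split; [apply: lV|apply: lV'] => //.
      exact: rW (leq_maxl l l') e.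
    exact: rW (leq_maxr l l') e.
  by exists l => z' Mz' e; apply/VV'/lV.
suff Gz : G --> z by apply: Gz; apply: open_nbhs_nbhs.
apply/cvg_sup => i V.
rewrite nbhsE => -[B [[C oC <-] Cz] BV].
have [l lC] := rM i C oC z Mz Cz.
by exists l => z' Mz' e; apply: BV; exact: lC.
Qed.

Section Cylinders.
Variable d : card_le_omega.
Local Notation D := (dset d).

Lemma dseq_prefix_continuous : prefix_continuous [set: dseq d] (fun l z => mkseq z l).
Proof.
apply: prefix_continuous_prod => [l l' z z' ll'|j U _ z _ Uz]; first exact: mkseqW.
by exists j.+1 => z' _ /mkseq_nthE/(_ j (ltnSn j)) ->.
Qed.

Lemma open_cylinder l (P : set (seq D)) : open [set z : dseq d | P (mkseq z l)].
Proof.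
have openE j (a : D) : open [set z : dseq d | z j = a].
  apply: (@open_comp (dseq d) (discrete_topology D) (fun z => z j) [set a]).
    by move=> z _; exact: (@proj_continuous nat (fun=> discrete_topology D) j).
  exact: discrete_open.
have open1 s : open [set z : dseq d | mkseq z l = s].
  have [<-|ls] := EM (size s = l); last first.
    rewrite (_ : mkset _ = set0); first exact: open0.
    by apply/seteqP; split=> // z /= zs; apply: ls; rewrite -zs size_mkseq.
  elim/last_ind: s => [|s a IHs].
    rewrite (_ : mkset _ = setT); first exact: openT.
    by apply/seteqP; split.
  rewrite (_ : mkset _ = [set z | mkseq z (size s) = s] `&` [set z | z (size s) = a]).
    exact: openI.
  rewrite size_rcons; apply/seteqP; split=> z /=; rewrite mkseqS.
    by move/rcons_inj => [].
  by case=> -> ->.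
rewrite (_ : mkset _ = \bigcup_(s in P) [set z : dseq d | mkseq z l = s]).
  exact: bigcup_open.
by apply/seteqP; split=> z /=; [move=> Pz; exists (mkseq z l)|case=> s Ps zs; rewrite zs].
Qed.

Section Body.
Variable M : set (dpow d).

Lemma open_coordinate (i : D) (U : set (dseq d)) : open U ->
  open [set z : set_type M | U (set_val z i)].
Proof.
move=> oU; apply: (@open_comp _ (dseq d) (fun z : set_type M => set_val z i) U) => // z _.
apply: (@continuous_comp _ _ _ set_val (fun z : dpow d => z i)).
  exact: initial_continuous.
exact: (@proj_continuous D (fun=> dseq d) i).
Qed.

Lemma dpow_prefix_continuous : prefix_continuous M (fun l z => rows z l).
Proof.
apply: prefix_continuous_prod => [l l' z z' ll'|i U oU z _ Uz]; first exact: mkseqW.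
have [l lU] := dseq_prefix_continuous oU I Uz.
exists l => z' _ /mkseq_nthE e; apply: lU => //; apply/mkseq_nthE => j jl.
exact: (congr1 (fun f : D -> D => f i) (e j jl)).
Qed.

End Body.
End Cylinders.

(** * The pulled-back sets and their non-separation *)

Section Main.
Variables (R : realType) (d : card_le_omega) (i0 i1 : dset d).
Hypotheses (i0E : val i0 = 0) (i1E : val i1 = 1).
Variables (t : nat -> seq (dset d -> dset d)) (lab : nat -> nat).
Hypothesis t_dense : forall s m, Tr t s ->
  exists k, [/\ size s <= k, t k = s ++ nseq (k - size s) (fun=> i0) & lab k = m].

Local Notation D := (dset d).
Local Notation BT := (body (Tr t)).

(** On the body, columns [i0] and [i1] differ at [j] exactly when the letter at [j] is the
    identity. *)
Definition labels (x : D -> nat -> D) : set nat :=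
  [set m | exists2 j, lab j = m & x i0 j <> x i1 j].

Lemma open_labels m : open [set z : set_type BT | labels (set_val z) m].
Proof.
rewrite (_ : mkset _ = \bigcup_(ja in [set ja : nat * D | lab ja.1 = m])
  ([set z : set_type BT | set_val z i0 ja.1 = ja.2] `&`
   [set z : set_type BT | set_val z i1 ja.1 <> ja.2])).
  apply: bigcup_open => -[j a] _.
  have openP i (P : set D) : open [set z : set_type BT | P (set_val z i j)].
    apply: (@open_coordinate _ _ i [set z | P (z j)]).
    have := @open_cylinder d j.+1 [set s | P (nth a s j)].
    rewrite (_ : [set z : dseq d | _ (mkseq z j.+1)] = [set z | P (z j)]) //.
    by apply/seteqP; split=> z /=; rewrite nth_mkseq.
  by apply: openI; [exact: (openP i0 [set b | b = a])|exact: (openP i1 [set b | b <> a])].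
apply/seteqP; split=> [z [j lj zj]|z [[j a] /= lj [<- zj]]].
  by exists (j, set_val z i0 j) => //; split=> //= e; apply: zj.
by exists j => // e; apply: zj.
Qed.

(** The columns [i0] and [i1] determine every letter of a point of the body, so countably many
    clopen sets suffice even for infinite [d]. *)
Lemma body_clopen_cover (U : set (set_type BT)) : open U ->
  exists2 B : nat -> set (set_type BT), forall n, clopen (B n) & U = \bigcup_n B n.
Proof.
move=> [V oV <-].
pose A : countType := {n | below d n}.
pose N (ab : seq A * seq A) : set (set_type BT) :=
  [set z | mkseq (set_val z i0) (size ab.1) = ab.1] `&`
  [set z | mkseq (set_val z i1) (size ab.2) = ab.2].
have clN ab : clopen (N ab).
  have cl1 i (s : seq A) : clopen [set z : set_type BT | mkseq (set_val z i) (size s) = s].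
    split.
      apply: (@open_coordinate _ _ i [set z | mkseq z (size s) = s]).
      exact: (@open_cylinder d (size s) [set u | u = s]).
    rewrite -openC; apply: (@open_coordinate _ _ i [set z | mkseq z (size s) <> s]).
    exact: (@open_cylinder d (size s) [set u | u <> s]).
  exact: clopenI.
have cl0 : clopen (set0 : set (set_type BT)) by split; [exact: open0|exact: closed0].
pose B n := if (unpickle n : option (seq A * seq A)) is Some ab then
  if `[< N ab `<=` set_val @^-1` V >] then N ab else set0 else set0.
exists B.
  move=> n; rewrite /B; case: unpickle => [ab|]; last exact: cl0.
  by case: asboolP => // _; exact: cl0.
apply/seteqP; split=> [z Vz|z [n _]]; last first.
  rewrite /B; case: unpickle => // ab; case: asboolP => // NV; exact: NV.
have [l lV] := @dpow_prefix_continuous d BT V oV (set_val z) (set_valP z) Vz.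
pose ab : seq A * seq A := (mkseq (set_val z i0) l, mkseq (set_val z i1) l).
exists (pickle ab) => //; rewrite /B pickleK; case: asboolP => [_|]; last first.
  case=> z' [/= e0 e1]; apply: lV; first exact: set_valP.
  move: e0 e1; rewrite !size_mkseq => /mkseq_nthE e0 /mkseq_nthE e1.
  apply/mkseq_nthE => j jl.
  have al (y : set_type BT) : allowed t (take j (rows (set_val y) l)) ((set_val y)^~ j).
    have Ty := set_valP y l; have := @Tr_nth _ _ _ j id Ty.
    by rewrite size_mkseq nth_mkseq // => /(_ jl).
  exact: (allowed_eq i0E i1E (al z') (al z) (e0 j jl) (e1 j jl)).
by split; rewrite /= size_mkseq.
Qed.

(** [M] consists of the points generic in each coordinate separately. There the finer topologies
    reduce to prefixes, and [diagonal] supplies points of the body. *)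
Lemma pot_diagonal (tau : forall i : D, Topological (dseq d)) :
  let Xt i : topologicalType := Topological.Pack (tau i) in
  (forall i (U : set (dseq d)), open U -> @open (Xt i) U) ->
  (forall i, polish R (Xt i)) ->
  exists M : set (prod_topology Xt),
    prefix_continuous M (fun l z => rows z l) /\
    forall g : nat -> nat -> seq (D -> D) -> Prop, exists z,
      [/\ M z, BT z & labels z = [set m | exists l, g m l (rows z l)]].
Proof.
move=> Xt finer pol.
pose A : countType := {n | below d n}.
have /choice[fam famP] i : exists fam, dense_family (adm i) fam /\
    forall U, @open (Xt i) U -> forall x, generic (adm i) fam x -> U x ->
    exists l, forall y, generic (adm i) fam y -> mkseq y l = mkseq x l -> U y.
  have [|fam ? ?] := @finer_polish_generic A (adm i) R (tau i) (pol i); last by exists fam.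
  move=> s; apply: finer; exact: (@open_cylinder d (size s) [set u | u = s]).
exists [set z | forall i, generic (adm i) (fam i) (z i)]; split.
  apply: prefix_continuous_prod => [l l' z z' ll'|i U oU z Mz Uz]; first exact: mkseqW.
  have [_ /(_ U oU (z i) (Mz i) Uz)[l lU]] := famP i.
  exists l => z' Mz' /mkseq_nthE e; apply: lU => //; apply/mkseq_nthE => j jl.
  exact: (congr1 (fun f : D -> D => f i) (e j jl)).
move=> g; have [x [Tx gx lx]] := diagonal i0E i1E t_dense g (fun i => (famP i).1).
by exists x; split=> //; apply/seteqP; split=> m /lx.
Qed.

End Main.

Theorem theorem3p1 (R : realType) (d : card_le_omega)
    (hd : if d is Finite_card m then 2 <= m else true) :
  exists T : set (seq (dset d -> dset d)),
    [/\ is_tree T, Delta11_suitable_levels T &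
      forall (W : countType) (le : rel W) (xi : W),
        wochoice.well_order le -> ord_ge1 le xi ->
        (exists S : set (set_type (body T)),
           Sigma0 le xi S /\
           ~ pot_separable R (Pi0 le xi)
               (set_val @` S) (body T `\` set_val @` S)) /\
        (exists S0 S1 : set (set_type (body T)),
           [/\ Sigma0 le xi S0, Sigma0 le xi S1, S0 `&` S1 = set0 &
             ~ pot_separable R (Delta0 le xi) (set_val @` S0) (set_val @` S1)])].
Proof.
have [i0 [i1 [i0E i1E]]] : exists i0 i1 : dset d, val i0 = 0 /\ val i1 = 1.
  have b0 : below d 0 by case: (d) hd => // m /ltnW.
  have b1 : below d 1 by case: (d) hd.
  by exists (exist _ 0 b0), (exist _ 1 b1).
have [t [lab t_dense]] := dense_words i0.
have suit : suitable_levels (Tr t).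
  by apply: Tr_suitable; exists i0, i1; exact: i01.
exists (Tr t); split.
- by move=> s s'; exact: Tr_catl.
- by split=> // l; apply: (level_Delta11 i0E); case: (suit l).
move=> W le xi wo xi1; have [C [_ _ CS Cg]] := complete_exists wo xi1.
have openL m := @open_labels d i0 i1 t lab m.
split.
  exists [set z | C (labels i0 i1 lab (set_val z))]; split; first exact: CS.
  case=> C' [[_ [tau [finer pol _ SC]]] SubC DisjC].
  have [M [Mr Mg]] := pot_diagonal i0E i1E t_dense finer pol.
  (* On [M], [g] reduces the complement of [C'] to [C]. At a point whose labels are the set computed
     by [g], being in the pulled-back set amounts to being outside [C']. *)
  have [g gP] := Cg _ _ _ _ Mr _ SC.
  have [z [Mz Bz labz]] := Mg g.
  have zE : (~` C') z <-> C (labels i0 i1 lab z) by rewrite labz; exact: gP.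
  have zS : C (labels i0 i1 lab z) -> C' z.
    by move=> Cz; apply: SubC; exists (exist _ z (mem_set Bz)).
  have nCz : ~ C (labels i0 i1 lab z) by move=> /[dup] /zS C'z /zE.
  have C'z : C' z by apply: contrapT => /zE.
  move/seteqP: DisjC => [/(_ z) dis _]; apply: dis.
  by split=> //; split=> // -[y Cy yz]; apply: nCz; rewrite -yz.
(* A boolean splits the labels into two halves; reduction makes the two pulled-back sets
   disjoint. *)
have sub_open b m : open [set z : set_type (body (Tr t)) |
    labels i0 i1 lab (set_val z) (pickle (b : bool, m : nat))] by exact: openL.
pose L (b : bool) z : set nat := [set m | labels i0 i1 lab z (pickle (b, m))].
have [S0 [S1 [[SS0 SS1] sub0 sub1 disj cov]]] := Sigma0_reduction wo
  (@body_clopen_cover d i0 i1 i0E i1E t) xi1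
  (CS _ (fun z : set_type (body (Tr t)) => L false (set_val z)) (sub_open false))
  (CS _ (fun z : set_type (body (Tr t)) => L true (set_val z)) (sub_open true)).
exists S0, S1; split=> //.
case=> C' [[_ [tau [finer pol _ [SC PC]]]] SubC DisjC].
have [M [Mr Mg]] := pot_diagonal i0E i1E t_dense finer pol.
have [g0 g0P] := Cg _ _ _ _ Mr _ PC.
have [g1 g1P] := Cg _ _ _ _ Mr _ SC.
(* The half [false] computes a reduction of the complement of [C'], the half [true] one of [C']. *)
pose g n l s := if (unpickle n : option (bool * nat)) is Some (b, m) then
  if b then g1 m l s else g0 m l s else False.
have [z [Mz Bz labz]] := Mg g.
have L0 : C (L false z) <-> (~` C') z.
  by rewrite /L labz /= /g; under eq_set do rewrite pickleK; apply: iff_sym; exact: g0P.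
have L1 : C (L true z) <-> C' z.
  by rewrite /L labz /= /g; under eq_set do rewrite pickleK; apply: iff_sym; exact: g1P.
pose y : set_type (body (Tr t)) := exist _ z (mem_set Bz).
(* [z] is in exactly one of the two pulled-back sets, so reduction leaves it in [S1] if it is in
   [C'] and in [S0] if not: the wrong side in both cases. *)
have [C'z|nC'z] := EM (C' z).
  have [S0y|S1y] : (S0 `|` S1) y by apply: cov; right; exact/L1.
    by have /L0 := sub0 _ S0y.
  move/seteqP: DisjC => [/(_ z) dis _]; apply: dis.
  by split=> //; exists y.
have [S0y|S1y] : (S0 `|` S1) y by apply: cov; left; exact/L0.
  by apply: nC'z; apply: SubC; exists y.
by have /L1 := sub1 _ S1y.
Qed.
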